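(* Consider the broken sample detection problem with joint distribution $\mathsf P_{X,Y}$ possibly depending on $n$. Assume that $I_{\chi^2}(X;Y)<\infty$ for every $n$ and that $m=(1-o(1))n$ as $n\to\infty$ (with $m\le n$). Suppose that either $\mathbb E_{\mathsf P_X}|\phi_1^3(X)|=o(\sqrt n)$ or $\mathbb E_{\mathsf P_Y}|\psi_1^3(Y)|=o(\sqrt m)$. Then the statistic $$T_{\mathrm{top}}=\Big(\frac1{\sqrt n}\sum_{i=1}^n\phi_1(X_i)-\frac1{\sqrt m}\sum_{i=1}^m\psi_1(Y_i)\Big)^2$$ achieves strong detection (by rejecting $\mathcal H_0$ when $T_{\mathrm{top}}$ is smaller than an appropriately chosen threshold, depending on $n$), provided that $$\lim_{n\to\infty}\rho(X;Y)=1.$$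
   Context: Broken sample detection problem. $\mathsf P_{X,Y}$ is a known joint distribution on a product space $\mathcal X\times\mathcal Y$ with marginals $\mathsf P_X,\mathsf P_Y$ (all may depend on $n$). One observes $\mathbf X=(X_1,\dots,X_n)\in\mathcal X^n$ and $\mathbf Y=(Y_1,\dots,Y_m)\in\mathcal Y^m$, $m=m_n\le n$. Under $\mathcal H_0$: $(\mathbf X,\mathbf Y)\sim \mathsf P_X^{\otimes n}\otimes\mathsf P_Y^{\otimes m}$. Under $\mathcal H_1$: $\pi$ is drawn uniformly from the set $S_{m,n}$ of injections $[m]\to[n]$, and conditionally on $\pi$ the pairs $(X_{\pi(i)},Y_i)$, $i\in[m]$, are i.i.d. from $\mathsf P_{X,Y}$ and, independently, the $X_j$, $j\in[n]\setminus\pi([m])$, are i.i.d. from $\mathsf P_X$. Only $(\mathbf X,\mathbf Y)$ is observed. A sequence of tests achieves strong detection if its Type-I and Type-II error probabilities both tend to $0$ as $n\to\infty$. $I_{\chi^2}(X;Y)=\chi^2(\mathsf P_{X,Y}\|\mathsf P_X\otimes\mathsf P_Y)$, where $\chi^2(P\|Q)=\int(\frac{dP}{dQ}-1)^2dQ$ if $P\ll Q$ and $\infty$ otherwise. When it is finite, the likelihood ratio $L=\frac{d\mathsf P_{X,Y}}{d(\mathsf P_X\otimes\mathsf P_Y)}$ lies in $L_2(\mathsf P_X\otimes\mathsf P_Y)$ and the Hilbert-Schmidt operator $(\mathcal L h)(x)=\mathbb E_{Y\sim\mathsf P_Y}[L(x,Y)h(Y)]$ from $L_2(\mathsf P_Y)$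 to $L_2(\mathsf P_X)$ yields the spectral decomposition $L(x,y)=\sum_{k\ge0}\lambda_k\phi_k(x)\psi_k(y)$, with $\{\phi_k\}$, $\{\psi_k\}$ orthonormal in $L_2(\mathsf P_X)$, $L_2(\mathsf P_Y)$, singular values $1=\lambda_0\ge\lambda_1\ge\lambda_2\ge\cdots\ge 0$, and $\phi_0=\psi_0\equiv1$. The maximal correlation is $\rho(X;Y)=\sup_{g,h}\{\mathbb E_{\mathsf P_{X,Y}}[g(X)h(Y)]:\mathbb E[g(X)]=\mathbb E[h(Y)]=0,\ \mathbb E[g^2(X)]=\mathbb E[h^2(Y)]=1\}$ and equals $\lambda_1$. *)

(* Defs.v *)
From HB Require Import structures.
From mathcomp Require Import all_boot all_order all_algebra.
From mathcomp Require Import all_classical all_reals all_analysis.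

Set Implicit Arguments.
Unset Strict Implicit.
Unset Printing Implicit Defensive.

Import Order.TTheory GRing.Theory Num.Theory.
Import numFieldNormedType.Exports.

Local Open Scope classical_set_scope.
Local Open Scope charge_scope.
Local Open Scope ring_scope.

Section projections.
Context d1 d2 (T1 : measurableType d1) (T2 : measurableType d2).

HB.instance Definition _ :=
  isMeasurableFun.Build _ _ (T1 * T2)%type T1 fst measurable_fst.
HB.instance Definition _ :=
  isMeasurableFun.Build _ _ (T1 * T2)%type T2 snd measurable_snd.

End projections.

Section iid.
Context d (T : measurableType d) (R : realType).

Definition tuple_cons n (p : T * n.-tuple T) : n.+1.-tuple T :=
  [the n.+1.-tuple T of p.1 :: p.2].

Lemma measurable_tuple_cons n :
  measurable_fun [set: T * n.-tuple T] (@tuple_cons n).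
Proof. exact: measurable_cons. Qed.

HB.instance Definition _ n := isMeasurableFun.Build _ _
  (T * n.-tuple T)%type (n.+1.-tuple T) (@tuple_cons n)
  (@measurable_tuple_cons n).

(* The n-fold product measure; see [iid_box]. *)
Fixpoint iid (P : probability T R) (n : nat) : probability (n.-tuple T) R :=
  match n with
  | 0 => dirac [tuple]
  | n'.+1 => distribution (P \x iid P n')%E (@tuple_cons n')
  end.

Lemma iid_box (P : probability T R) n (A : 'I_n -> set T) :
  (forall i, measurable (A i)) ->
  iid P n [set t | forall i, A i (tnth t i)] = (\prod_(i < n) P (A i))%E.
Proof.
elim: n A => [|n IH] A mA.
  rewrite big_ord0 /= diracE mem_set//; by case.
rewrite big_ord_recl /= /distribution /pushforward.
pose B := [set t : n.-tuple T | forall i, A (lift ord0 i) (tnth t i)].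
have mB : measurable B.
  rewrite (_ : B = \big[setI/setT]_(i < n)
      ((fun t : n.-tuple T => tnth t i) @^-1` A (lift ord0 i))).
    apply: bigsetI_measurable => i _; rewrite -[X in measurable X]setTI.
    exact: measurable_tnth.
  by rewrite -bigcap_seq; apply/seteqP; split => t /= h i;
    [move=> _; exact: h|apply: h; rewrite /= mem_index_enum].
rewrite (_ : _ @^-1` _ = A ord0 `*` B); last first.
  apply/seteqP; split => [[x t] /= h|[x t] /= [hx ht] i].
    split => [|i] /=; first exact: (h ord0).
    by have := h (lift ord0 i); rewrite tnthS.
  case: (unliftP ord0 i) => [j ->|->] //=.
  by rewrite tnthS; exact: ht.
rewrite product_measure1E//; congr (_ * _)%E.
exact: (IH (fun i => A (lift ord0 i))).
Qed.

End iid.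

Section dependence.
Context d1 d2 (X : measurableType d1) (Y : measurableType d2) (R : realType).
Variable P : probability (X * Y)%type R.

Definition marginalX : probability X R := distribution P fst.

Definition marginalY : probability Y R := distribution P snd.

Definition product_marginals : probability (X * Y)%type R :=
  (marginalX \x marginalY)%E.

(* The value -oo for an empty supremum only occurs when one of the marginals
   carries no function of mean 0 and variance 1. *)
Definition maximal_correlation : \bar R :=
  ereal_sup [set c | exists (g : X -> R) (h : Y -> R),
    [/\ g \in Lfun marginalX 2%:E /\ h \in Lfun marginalY 2%:E,
        ('E_marginalX[g] = 0 /\ 'E_marginalY[h] = 0)%E,
        ('E_marginalX[fun x => (g x ^+ 2)%R] = 1 /\
         'E_marginalY[fun y => (h y ^+ 2)%R] = 1)%E &
        (c = 'E_P[fun w => (g w.1 * h w.2)%R])%E]].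

End dependence.

Definition chi2 d (T : measurableType d) (R : realType)
    (P Q : probability T R) : \bar R :=
  if `[< P `<< Q >]
  then (\int[Q]_w ('d (charge_of_finite_measure P) '/d Q w - 1) ^+ 2)%E
  else +oo%E.

Section likelihood_ratio.
Context d1 d2 (X : measurableType d1) (Y : measurableType d2) (R : realType).
Variable P : probability (X * Y)%type R.

Definition chi2_information : \bar R := chi2 P (product_marginals P).

Definition likelihood_ratio (w : X * Y) : R :=
  fine ('d (charge_of_finite_measure P) '/d (product_marginals P) w)%E.

End likelihood_ratio.

Definition orthonormal_on d (T : measurableType d) (R : realType)
    (Q : probability T R) (I : set nat) (f : nat -> T -> R) : Prop :=
  (forall k, f k \in Lfun Q 2%:E) /\
  (forall j k, I j -> I k ->
    ('E_Q[fun x => (f j x * f k x)%R] = ((j == k)%:R)%R%:E)%E).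

(* L = \sum_k lambda_k phi_k psi_k in L_2(P_X (x) P_Y).  When an L_2 space is
   finite-dimensional there are only finitely many singular functions; the
   sequences are then continued with lambda_k = 0 and arbitrary L_2 functions,
   which is why orthonormality is required on {k | 0 < lambda_k} only. *)
Definition spectral_decomposition d1 d2 (X : measurableType d1)
    (Y : measurableType d2) (R : realType) (P : probability (X * Y)%type R)
    (lambda : nat -> R) (phi : nat -> X -> R) (psi : nat -> Y -> R) : Prop :=
  [/\ lambda 0%N = 1 /\ (forall k, 0 <= lambda k.+1 <= lambda k),
      orthonormal_on (marginalX P) [set k | 0 < lambda k] phi,
      orthonormal_on (marginalY P) [set k | 0 < lambda k] psi,
      {ae marginalX P, forall x, phi 0%N x = 1} /\
      {ae marginalY P, forall y, psi 0%N y = 1} &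
      (\int[product_marginals P]_w
         ((likelihood_ratio P w
           - \sum_(0 <= k < N) lambda k * phi k w.1 * psi k w.2) ^+ 2)%:E)%E
        @[N --> \oo] --> 0%E].

Section hypotheses.
Context d1 d2 (X : measurableType d1) (Y : measurableType d2) (R : realType).
Variables (P : probability (X * Y)%type R) (n m : nat).

Definition null_law : set (n.-tuple X * m.-tuple Y) -> \bar R :=
  (iid (marginalX P) n \x iid (marginalY P) m)%E.

Definition injections : {pred {ffun 'I_m -> 'I_n}} :=
  [pred pi : {ffun 'I_m -> 'I_n} | injectiveb pi].

(* s.1 holds the pairs (X_(pi i), Y_i) and s.2 is an independent sample from
   P_X, of which only the coordinates outside the image of pi are used. *)
Definition plant (pi : {ffun 'I_m -> 'I_n})
    (s : m.-tuple (X * Y)%type * n.-tuple X) : n.-tuple X * m.-tuple Y :=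
  ([tuple if [pick i | pi i == j] is Some i
          then (tnth s.1 i).1 else tnth s.2 j | j < n],
   [tuple (tnth s.1 i).2 | i < m]).

Lemma measurable_plant pi : measurable_fun setT (plant pi).
Proof.
apply: measurable_fun_pair; apply/measurable_fun_tnthP => j.
- rewrite (_ : _ \o _ = fun s => if [pick i | pi i == j] is Some i
      then (tnth s.1 i).1 else tnth s.2 j); last first.
    by apply/funext => s /=; rewrite tnth_mktuple.
  case: pickP => [i _|_].
  + apply: (measurableT_comp measurable_fst).
    exact: (measurableT_comp (measurable_tnth i)).
  + exact: (measurableT_comp (measurable_tnth j)).
- rewrite (_ : _ \o _ = fun s => (tnth s.1 j).2); last first.
    by apply/funext => s /=; rewrite tnth_mktuple.
  apply: (measurableT_comp measurable_snd).
  exact: (measurableT_comp (measurable_tnth j)).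
Qed.

HB.instance Definition _ pi :=
  isMeasurableFun.Build _ _ _ _ (plant pi) (measurable_plant pi).

Definition conditional_law (pi : {ffun 'I_m -> 'I_n}) :
    probability (n.-tuple X * m.-tuple Y)%type R :=
  distribution (iid P m \x iid (marginalX P) n)%E (plant pi).

Definition planted_law (A : set (n.-tuple X * m.-tuple Y)) : \bar R :=
  ((#|injections|%:R^-1)%:E *
   \sum_(pi in injections) conditional_law pi A)%E.

Definition T_top (phi1 : X -> R) (psi1 : Y -> R)
    (w : n.-tuple X * m.-tuple Y) : R :=
  ((Num.sqrt n%:R)^-1 * (\sum_(i < n) phi1 (tnth w.1 i))
   - (Num.sqrt m%:R)^-1 * (\sum_(i < m) psi1 (tnth w.2 i))) ^+ 2.

End hypotheses.

Arguments null_law {d1 d2 X Y R} P n m.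
Arguments planted_law {d1 d2 X Y R} P n m.

(* [rej n] is the set of observations for which the n-th test rejects H_0. *)
Definition strong_detection (R : realType) (Omega : nat -> Type)
    (H0 H1 : forall n, set (Omega n) -> \bar R)
    (rej : forall n, set (Omega n)) : Prop :=
  (H0 n (rej n) @[n --> \oo] --> 0%E) /\
  (H1 n (~` rej n) @[n --> \oo] --> 0%E).

(* Main.v *)
Require Import Defs.
From HB Require Import structures.
From mathcomp Require Import all_boot all_order all_algebra.
From mathcomp Require Import all_classical all_reals all_analysis.
From mathcomp Require Import measurable_realfun ring lra.

(** Write [A] for the normalized sum of [phi 1] over the [X_i] and [B] for that
    of [psi 1] over the [Y_i], so that [T_top] is [(A - B) ^+ 2].

    Under the planted law, conditionally on the injection, [A - B] is a sum of
    independent centred terms, and its variance is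
    [2 - 2 * lambda 1 * sqrt (m / n)] ([has_mean_planted_T_top]). This tends to
    [0] because [m / n] tends to [1] and [lambda 1] tends to [1]. The latter
    holds because the maximal correlation is at most [lambda 1]
    ([maximal_correlation_le]): the expansion of the likelihood ratio expresses
    a correlation as the limit of [\sum_k lambda k * a k * b k], where [a] and
    [b] are coefficients on orthonormal systems, and Bessel's inequality applies.
    Markov's inequality then bounds the type-II error.

    Under the null law [A] and [B] are independent, so [A - B] being small
    means that one of the two sums falls in a short interval whose centre can
    be regarded as fixed. The sum with small third moment does so with small
    probability, uniformly in the centre ([concentration_normalized_sum]).
    This is a weak form of the central limit theorem. One dominates the indicator of an interval of radius [s] by
    [2 * s] times a Gaussian kernel of width [s]. Integrating out one summand
    moves this kernel by one Euler step of the heat equation, up to a third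
    moment ([heat_kernel_space]); the exact heat flow dominates that step up to
    an error of second order in time ([heat_kernel_time]). After all the
    summands are integrated out, unit time has elapsed and the kernel has height
    at most [1], so that the probability is at most [2 * s] plus the errors,
    which are the third moment over [sqrt n] and [1 / n], divided by powers
    of [s].

    If [q] dominates the three vanishing quantities (the variance, the normalized
    third moment and [1 / n]), then [s] equal to the eighth root of [q] makes all
    error bounds vanish, with threshold [s ^+ 2] ([strong_detection_of_rates]). *)

Set Implicit Arguments.
Unset Strict Implicit.
Unset Printing Implicit Defensive.

Import Order.TTheory GRing.Theory Num.Theory.
Import numFieldNormedType.Exports.

Local Open Scope classical_set_scope.
Local Open Scope ring_scope.

(** * Finite expectations *)

Section finite_mean.
Context d (T : measurableType d) (R : realType).
Implicit Types (Q : probability T R) (f g : T -> R).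

Definition has_mean Q f (a : R) :=
  Q.-integrable setT (EFin \o f) /\ (\int[Q]_x (f x)%:E = a%:E)%E.

Lemma has_mean_measurable Q f a : has_mean Q f a -> measurable_fun setT f.
Proof. by move=> [/measurable_int/measurable_EFinP]. Qed.

Lemma has_mean_unique Q f a b : has_mean Q f a -> has_mean Q f b -> a = b.
Proof. by move=> [_ fa] [_]; rewrite fa => -[]. Qed.

Lemma eq_has_mean Q f g a : f =1 g -> has_mean Q f a -> has_mean Q g a.
Proof. by move=> /funext ->. Qed.

Lemma integrable_has_mean Q f :
  Q.-integrable setT (EFin \o f) -> has_mean Q f (\int[Q]_x f x).
Proof.
by move=> fi; split => //; rewrite fineK//; exact: integrable_fin_num.
Qed.

Lemma has_mean_cst Q c : has_mean Q (cst c) c.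
Proof.
split; first exact: finite_measure_integrable_cst.
have /= -> := @integral_cst _ _ _ Q setT measurableT c%:E.
by have -> : Q setT = 1%E := probability_setT Q; rewrite mule1.
Qed.

Lemma has_meanD Q f g a b :
  has_mean Q f a -> has_mean Q g b -> has_mean Q (fun x => f x + g x) (a + b).
Proof.
move=> [fi fa] [gi gb]; split.
  by rewrite (_ : _ \o _ = (EFin \o f) \+ (EFin \o g))%E//; exact: integrableD.
by under eq_integral do rewrite EFinD; rewrite integralD// fa gb.
Qed.

Lemma has_meanZ Q f a c : has_mean Q f a -> has_mean Q (fun x => c * f x) (c * a).
Proof.
move=> [fi fa]; split.
  rewrite (_ : _ \o _ = fun x => c%:E * (EFin \o f) x)%E//.
  exact: integrableZl.
by under eq_integral do rewrite EFinM; rewrite integralZl// fa.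
Qed.

Lemma has_meanB Q f g a b :
  has_mean Q f a -> has_mean Q g b -> has_mean Q (fun x => f x - g x) (a - b).
Proof.
move=> fa /(has_meanZ (-1)) gb; rewrite -mulN1r.
by apply: eq_has_mean (has_meanD fa gb) => x /=; rewrite mulN1r.
Qed.

Lemma has_mean_sum Q (I : Type) (s : seq I) (p : pred I) (f : I -> T -> R)
    (a : I -> R) : (forall i, has_mean Q (f i) (a i)) ->
  has_mean Q (fun x => \sum_(i <- s | p i) f i x) (\sum_(i <- s | p i) a i).
Proof.
move=> fa; elim: s => [|i s IH].
  rewrite big_nil; apply: eq_has_mean (has_mean_cst Q 0) => x.
  by rewrite big_nil.
rewrite big_cons; case: ifPn => pi.
  by apply: eq_has_mean (has_meanD (fa i) IH) => x; rewrite big_cons pi.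
by apply: eq_has_mean IH => x; rewrite big_cons (negbTE pi).
Qed.

Lemma has_mean_le Q f g a b : (forall x, f x <= g x) ->
  has_mean Q f a -> has_mean Q g b -> a <= b.
Proof.
move=> fg [fi fa] [gi gb]; rewrite -lee_fin -fa -gb.
by apply: le_integral => // x _; rewrite lee_fin.
Qed.

Lemma has_mean_ge0 Q f a : (forall x, 0 <= f x) -> has_mean Q f a -> 0 <= a.
Proof. by move=> f0; apply: has_mean_le f0 (has_mean_cst Q 0). Qed.

Lemma has_mean_ae Q f g a : measurable_fun setT g ->
  {ae Q, forall x, f x = g x} -> has_mean Q f a -> has_mean Q g a.
Proof.
move=> mg fg [fi fa].
have mf : measurable_fun setT (EFin \o f) by exact: measurable_int fi.
have mg' : measurable_fun setT (EFin \o g) by exact/measurable_EFinP.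
have aefg : ae_eq Q setT (EFin \o f) (EFin \o g).
  by apply: filterS fg => x /= fgx _; rewrite fgx.
split; last by rewrite -fa; apply/esym/ae_eq_integral.
apply/integrableP; split => //.
have [_] := integrableP _ _ _ fi; congr (_ < _)%E.
apply: ae_eq_integral => //; [exact: measurableT_comp|exact: measurableT_comp|].
by apply: filterS fg => x /= fgx _; rewrite fgx.
Qed.

Lemma has_mean_expectation Q f a :
  Q.-integrable setT (EFin \o f) -> 'E_Q[f]%E = a%:E -> has_mean Q f a.
Proof. by move=> fi; rewrite unlock. Qed.

Lemma has_mean_scaled_expectation Q f c :
  measurable_fun setT f -> (forall x, 0 <= f x) -> 0 < c ->
  ('E_Q[f] * c%:E)%E \is a fin_num ->
  exists2 b, has_mean Q f b & b * c = fine ('E_Q[f] * c%:E)%E.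
Proof.
move=> mf f0 c0; rewrite unlock.
have I0 : (0 <= \int[Q]_x (f x)%:E)%E by apply: integral_ge0 => x _; rewrite lee_fin.
case E : (\int[Q]_x (f x)%:E)%E I0 => [b| |] // _; last first.
  by rewrite gt0_mulye// lte_fin.
exists b => //; split => //; apply/integrableP; split; first exact/measurable_EFinP.
under eq_integral do rewrite /= ger0_norm//.
by rewrite E ltry.
Qed.

(** Square integrability, phrased without norms or exponents so that Hilbert
    space computations become linear manipulations of expectations. *)
Definition square_integrable Q f :=
  measurable_fun setT f /\ Q.-integrable setT (EFin \o (fun x => f x ^+ 2)).

Lemma Lfun2_square_integrable Q f :
  f \in Lfun Q 2%:E -> square_integrable Q f.
Proof.
move=> fL; split; last exact: Lfun2_integrable_sqr.
by move: fL => /sub_Lfun_mfun; rewrite inE.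
Qed.

Lemma square_integrable_mul Q f g :
  square_integrable Q f -> square_integrable Q g ->
  has_mean Q (fun x => f x * g x) (\int[Q]_x (f x * g x)).
Proof.
move=> [mf fi] [mg gi]; apply: integrable_has_mean.
have := integrableD measurableT fi gi.
apply: le_integrable => //.
  by apply/measurable_EFinP; exact: measurable_funM.
move=> x _; rewrite /= lee_fin normrM [leRHS]ger0_norm ?addr_ge0 ?sqr_ge0//.
rewrite -(real_normK (num_real (f x))) -(real_normK (num_real (g x))).
have := sqr_ge0 (`|f x| - `|g x|).
have := normr_ge0 (f x); have := normr_ge0 (g x); nra.
Qed.

Lemma square_integrable_cst Q c : square_integrable Q (cst c).
Proof.
split; first exact: measurable_cst.
by have [] := has_mean_cst Q (c ^+ 2).
Qed.

Lemma square_integrableD Q f g : square_integrable Q f ->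
  square_integrable Q g -> square_integrable Q (fun x => f x + g x).
Proof.
move=> sf sg; split; first by apply: measurable_funD; [case: sf|case: sg].
have [] := has_meanD (has_meanD (square_integrable_mul sf sf)
  (has_meanZ 2 (square_integrable_mul sf sg))) (square_integrable_mul sg sg).
move=> + _; apply: eq_integrable => // x _ /=; congr EFin; ring.
Qed.

Lemma square_integrableZ Q f c : square_integrable Q f ->
  square_integrable Q (fun x => c * f x).
Proof.
move=> sf; split; first by apply: measurable_funM => //; case: sf.
have [] := has_meanZ (c ^+ 2) (square_integrable_mul sf sf).
move=> + _; apply: eq_integrable => // x _ /=; congr EFin; ring.
Qed.

Lemma square_integrable_sum Q (I : Type) (s : seq I) (p : pred I)
    (f : I -> T -> R) : (forall i, square_integrable Q (f i)) ->
  square_integrable Q (fun x => \sum_(i <- s | p i) f i x).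
Proof.
move=> sf; elim: s => [|i s IH].
  under eq_fun do rewrite big_nil; exact: square_integrable_cst.
under eq_fun do rewrite big_cons; case: (p i) => //.
exact: square_integrableD.
Qed.

Lemma has_mean_mul_ae1 Q (e g : T -> R) a :
  {ae Q, forall x, e x = 1} -> square_integrable Q e ->
  measurable_fun setT g -> has_mean Q g a <-> has_mean Q (fun x => g x * e x) a.
Proof.
move=> e1 [me _] mg; split; apply: has_mean_ae => //.
- exact: measurable_funM.
- by apply: filterS e1 => x ->; rewrite mulr1.
- by apply: filterS e1 => x ->; rewrite mulr1.
Qed.

Lemma has_mean_Cauchy_Schwarz Q f g a b c :
  has_mean Q (fun x => f x * f x) a -> has_mean Q (fun x => g x * g x) b ->
  has_mean Q (fun x => f x * g x) c -> c ^+ 2 <= a * b.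
Proof.
move=> fa gb fgc.
have key t : 0 <= a - 2 * t * c + t ^+ 2 * b.
  apply: has_mean_ge0 (has_meanD (has_meanB fa (has_meanZ (2 * t) fgc))
    (has_meanZ (t ^+ 2) gb)) => x.
  by rewrite [leRHS](_ : _ = (f x - t * g x) ^+ 2) ?sqr_ge0//; ring.
have b0 : 0 <= b by apply: has_mean_ge0 gb => x; rewrite -expr2 sqr_ge0.
have [b1|b1] := eqVneq b 0.
  have [->|c0] := eqVneq c 0; first by rewrite b1; lra.
  (* With [b = 0] this value of [t] would make the quadratic equal to [-1]. *)
  have := key ((a + 1) / (2 * c)); rewrite b1 mulr0 addr0.
  by rewrite (_ : a - _ = -1); [lra|field].
have {}b0 : 0 < b by rewrite lt_def b1.
have := key (c / b); rewrite (_ : _ + _ = (a * b - c ^+ 2) / b); last by field.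
by rewrite pmulr_lge0 ?invr_gt0// subr_ge0.
Qed.

(** Bessel's inequality: the second moment of [g] minus its projection is
    nonnegative, and orthonormality makes it [v] minus the sum. *)
Lemma Bessel Q (s : seq nat) (e : nat -> T -> R) g a v :
  uniq s -> (forall k, square_integrable Q (e k)) -> square_integrable Q g ->
  (forall j k, j \in s -> k \in s ->
    has_mean Q (fun x => e j x * e k x) (j == k)%:R) ->
  (forall k, k \in s -> has_mean Q (fun x => g x * e k x) (a k)) ->
  has_mean Q (fun x => g x * g x) v ->
  \sum_(k <- s) a k ^+ 2 <= v.
Proof.
move=> us se sg ee ge gv; pose p x := \sum_(k <- s) a k * e k x.
have sum_in (I : eqType) (r : seq I) (f : I -> T -> R) b :
    (forall i, i \in r -> has_mean Q (f i) (b i)) ->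
    has_mean Q (fun x => \sum_(i <- r) f i x) (\sum_(i <- r) b i).
  elim: r => [|i r IH] fb.
    rewrite big_nil; apply: eq_has_mean (has_mean_cst Q 0) => x.
    by rewrite big_nil.
  rewrite big_cons; apply: (eq_has_mean (fun x => esym (big_cons _ _ _ _ _ _))).
  apply: has_meanD; first by apply: fb; rewrite mem_head.
  by apply: IH => j jr; apply: fb; rewrite in_cons jr orbT.
have gp : has_mean Q (fun x => g x * p x) (\sum_(k <- s) a k ^+ 2).
  have := @sum_in _ s (fun k x => a k * (g x * e k x)) (fun k => a k * a k)
    (fun k ks => has_meanZ (a k) (ge k ks)).
  apply: eq_has_mean => x; rewrite /p mulr_sumr; apply: eq_bigr => k _; ring.
have pp : has_mean Q (fun x => p x * p x) (\sum_(k <- s) a k ^+ 2).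
  rewrite (_ : \sum_(k <- s) _ =
      \sum_(k <- s) \sum_(j <- s) a k * (a j * (k == j)%:R)).
    have := @sum_in _ s (fun k x => \sum_(j <- s) a k * (a j * (e k x * e j x)))
      _ (fun k ks => @sum_in _ s _ _ (fun j js =>
          has_meanZ (a k) (has_meanZ (a j) (ee k j ks js)))).
    apply: eq_has_mean => x; rewrite /p mulr_suml; apply: eq_bigr => k _.
    rewrite mulr_sumr; apply: eq_bigr => j _; ring.
  apply: eq_big_seq => k ks; rewrite (bigD1_seq k)//= eqxx mulr1 big1 ?addr0//.
  by move=> j /negbTE; rewrite eq_sym => ->; rewrite !mulr0.
have := has_mean_ge0 _ (has_meanD (has_meanB gv (has_meanZ 2 gp)) pp).
set A := \sum_(k <- s) _; suff h : forall x,
    0 <= g x * g x - 2 * (g x * p x) + p x * p x by move=> /(_ h); lra.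
by move=> x; rewrite [leRHS](_ : _ = (g x - p x) ^+ 2) ?sqr_ge0//; ring.
Qed.

End finite_mean.

Section transport.
Context d1 d2 (T1 : measurableType d1) (T2 : measurableType d2) (R : realType).

Lemma has_mean_distribution (Q : probability T1 R) (phi : {mfun T1 >-> T2})
    (f : T2 -> R) a : measurable_fun setT f ->
  has_mean (distribution Q phi) f a <-> has_mean Q (f \o phi) a.
Proof.
move=> /measurable_EFinP mf; rewrite /has_mean.
have iP : (distribution Q phi).-integrable setT (EFin \o f) <->
    Q.-integrable setT (EFin \o (f \o phi)).
  split => [/integrableP[_ fi]|fi].
    apply/integrableP; split; first exact: (measurableT_comp mf).
    move: fi; rewrite ge0_integral_distribution//.
    exact: measurableT_comp.
  apply: (integrable_pushforward _ (mu := Q) (phi := phi)) => //.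
split=> -[fi <-]; split; try exact/iP.
  by rewrite integral_distribution//; exact/iP.
by rewrite integral_distribution//; exact/iP.
Qed.

Lemma square_integrable_distribution (Q : probability T1 R)
    (phi : {mfun T1 >-> T2}) (f : T2 -> R) :
  square_integrable (distribution Q phi) f -> square_integrable Q (f \o phi).
Proof.
move=> [mf /integrable_has_mean fi]; split; first exact: measurableT_comp.
by case/has_mean_distribution: fi => //; exact: measurable_funX.
Qed.

Lemma has_mean_prod (Q1 : probability T1 R) (Q2 : probability T2 R)
    (f : T1 -> R) (g : T2 -> R) a b : has_mean Q1 f a -> has_mean Q2 g b ->
  has_mean (Q1 \x Q2)%E (fun w => f w.1 * g w.2) (a * b).
Proof.
move=> fa gb.
have mf := has_mean_measurable fa; have mg := has_mean_measurable gb.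
have mfg : measurable_fun setT
    (fun w : T1 * T2 => (f w.1 * g w.2)%:E).
  by apply/measurable_EFinP/measurable_funM; exact: measurableT_comp.
have fgi : (Q1 \x Q2)%E.-integrable setT
    (fun w : T1 * T2 => (f w.1 * g w.2)%:E).
  apply/integrable12ltyP => //=.
  have [gi _] := gb; have [fi _] := fa.
  have gn := integrable_has_mean (integrable_norm gi).
  have fn := integrable_has_mean (integrable_norm fi).
  set K := (\int[Q2]_x (Num.norm \o g) x)%R in gn.
  rewrite (_ : (\int[Q1]_x _)%E = (\int[Q1]_x (K * (Num.norm \o f) x)%:E)%E).
    by have [_ ->] := has_meanZ K fn; rewrite ltry.
  apply: eq_integral => x _; have [_] := has_meanZ `|f x| gn.
  rewrite mulrC => <-; apply: eq_integral => y _ /=.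
  by rewrite normrM.
split => //.
rewrite -integral12_prod_meas1//=.
have [_] := has_meanZ b fa; rewrite mulrC => <-.
apply: eq_integral => x _.
by have [_] := has_meanZ (f x) gb; rewrite mulrC.
Qed.

Lemma has_mean_prod1 (Q1 : probability T1 R) (Q2 : probability T2 R)
    (f : T1 -> R) a : has_mean Q1 f a ->
  has_mean (Q1 \x Q2)%E (fun w => f w.1) a.
Proof.
move=> /has_mean_prod/(_ (has_mean_cst Q2 1)); rewrite mulr1.
by apply: eq_has_mean => w; rewrite mulr1.
Qed.

Lemma has_mean_prod2 (Q1 : probability T1 R) (Q2 : probability T2 R)
    (f : T2 -> R) a : has_mean Q2 f a ->
  has_mean (Q1 \x Q2)%E (fun w => f w.2) a.
Proof.
move=> /(has_mean_prod (has_mean_cst Q1 1)); rewrite mul1r.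
by apply: eq_has_mean => w; rewrite mul1r.
Qed.

(** The cross term factorizes under the product measure, and its factors are
    the two zero means. *)
Lemma variance_prod (Q1 : probability T1 R) (Q2 : probability T2 R)
    (U : T1 -> R) (V : T2 -> R) u v :
  has_mean Q1 U 0 -> has_mean Q1 (fun x => U x ^+ 2) u ->
  has_mean Q2 V 0 -> has_mean Q2 (fun x => V x ^+ 2) v ->
  has_mean (Q1 \x Q2)%E (fun w => U w.1 + V w.2) 0 /\
  has_mean (Q1 \x Q2)%E (fun w => (U w.1 + V w.2) ^+ 2) (u + v).
Proof.
move=> U0 Uu V0 Vv; split.
  rewrite -[X in has_mean _ _ X](addr0 0).
  exact: has_meanD (has_mean_prod1 _ U0) (has_mean_prod2 _ V0).
have := has_meanD (has_meanD (has_mean_prod1 Q2 Uu)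
  (has_meanZ 2 (has_mean_prod U0 V0))) (has_mean_prod2 Q1 Vv).
rewrite mul0r mulr0 addr0; apply: eq_has_mean => w; ring.
Qed.

End transport.

Section iid_sums.
Context d (T : measurableType d) (R : realType).

Lemma measurable_sum_tnth n (f : 'I_n -> T -> R) :
  (forall i, measurable_fun setT (f i)) ->
  measurable_fun setT (fun t : n.-tuple T => \sum_(i < n) f i (tnth t i)).
Proof.
move=> mf; apply: measurable_sum => i.
by apply: (measurableT_comp (mf i)); exact: measurable_tnth.
Qed.

Lemma variance_iid (Q : probability T R) n (f : 'I_n -> T -> R) v :
  (forall i, has_mean Q (f i) 0) ->
  (forall i, has_mean Q (fun x => f i x ^+ 2) (v i)) ->
  has_mean (iid Q n) (fun t => \sum_(i < n) f i (tnth t i)) 0 /\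
  has_mean (iid Q n) (fun t => (\sum_(i < n) f i (tnth t i)) ^+ 2)
    (\sum_(i < n) v i).
Proof.
elim: n f v => [|n IH] f v f0 fv.
  rewrite big_ord0; split; apply: eq_has_mean (has_mean_cst _ 0) => t /=.
    by rewrite big_ord0.
  by rewrite big_ord0 expr0n.
have ms : measurable_fun setT
    (fun t : n.+1.-tuple T => \sum_(i < n.+1) f i (tnth t i)).
  by apply: measurable_sum_tnth => i; exact: has_mean_measurable (f0 i).
have [S0 Sv] := IH (fun i => f (lift ord0 i)) (fun i => v (lift ord0 i))
  (fun i => f0 _) (fun i => fv _).
have [U0 Uv] := variance_prod (f0 ord0) (fv ord0) S0 Sv.
have E (w : T * n.-tuple T) : f ord0 w.1 + \sum_(i < n) f (lift ord0 i) (tnth w.2 i) =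
    \sum_(i < n.+1) f i (tnth (tuple_cons w) i).
  rewrite big_ord_recl; congr (_ + _); apply: eq_bigr => i _.
  by rewrite tnthS.
split; apply/has_mean_distribution => //.
- by apply: eq_has_mean U0 => w; rewrite E.
- exact: measurable_funX.
- by rewrite big_ord_recl; apply: eq_has_mean Uv => w /=; rewrite E.
Qed.

End iid_sums.

(** * Anti-concentration of normalized sums *)

Section gaussian_kernel.
Variable R : realType.
Implicit Types (x y z w s r t : R).

Lemma nonpositive_of_derivative (F dF : R -> R) :
  (forall x, is_derive x 1 F (dF x)) -> F 0 <= 0 ->
  (forall x, 0 <= x -> dF x <= 0) -> forall x, 0 <= x -> F x <= 0.
Proof.
move=> FdF F0 dF0 x; rewrite le_eqVlt => /predU1P[<-//|x0].
have Fc : {within `[0, x], continuous F}.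
  apply: continuous_subspaceT => y.
  by apply/differentiable_continuous/derivable1_diffP; have [] := FdF y.
have [c cx FE] := MVT x0 (fun z _ => FdF z) Fc.
move: cx; rewrite in_itv/= => /andP[c0 _].
rewrite subr0 in FE; have := mulr_le0_ge0 (dF0 c (ltW c0)) (ltW x0).
by rewrite -FE; lra.
Qed.

Lemma is_derive_shift (f df : R -> R) z w :
  (forall x, is_derive x 1 f (df x)) ->
  is_derive w 1 (fun w => f (z + w)) (df (z + w)).
Proof.
move=> fdf; have h : is_derive w (1 : R) (fun w => z + w) (1 : R).
  by apply: is_derive_eq; rewrite add0r mulr1.
apply: (is_derive_eq (@is_derive1_comp R f (fun w => z + w) w _ _ (fdf _) h)).
exact: mulr1.
Qed.

(** The bound on the third derivative is integrated three times; only the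
    upper side of the remainder is ever used. *)
Lemma taylor3_le (f f1 f2 f3 : R -> R) M z w :
  (forall x, is_derive x 1 f (f1 x)) -> (forall x, is_derive x 1 f1 (f2 x)) ->
  (forall x, is_derive x 1 f2 (f3 x)) -> (forall x, f3 x <= M) -> 0 <= w ->
  f (z + w) <= f z + w * f1 z + w ^+ 2 / 2 * f2 z + M / 6 * w ^+ 3.
Proof.
move=> d1 d2 d3 f3M.
have h1 x := is_derive_shift z x d1.
have h2 x := is_derive_shift z x d2.
have h3 x := is_derive_shift z x d3.
have [a fz] : exists a, f z = a by exists (f z).
have [b f1z] : exists b, f1 z = b by exists (f1 z).
have [c f2z] : exists c, f2 z = c by exists (f2 z).
move=> w0; rewrite fz f1z f2z -subr_le0.
pose F2 w := f2 (z + w) - (c + M * w).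
have F2_le0 : forall w, 0 <= w -> F2 w <= 0.
  apply: (nonpositive_of_derivative (dF := fun w => f3 (z + w) - M)).
  - by move=> x; rewrite /F2; apply: is_derive_eq; rewrite /GRing.scale/=; ring.
  - by rewrite /F2 addr0 mulr0 addr0 f2z subrr.
  - by move=> x _; rewrite subr_le0.
pose F1 w := f1 (z + w) - (b + c * w + M / 2 * w ^+ 2).
have F1_le0 : forall w, 0 <= w -> F1 w <= 0.
  apply: (nonpositive_of_derivative (dF := F2)); last exact: F2_le0.
  - by move=> x; rewrite /F1; apply: is_derive_eq; rewrite /F2 /GRing.scale/=; field.
  - by rewrite /F1 expr0n/= !(addr0, mulr0) f1z subrr.
move: w w0; apply: (nonpositive_of_derivative (dF := F1)); last exact: F1_le0.
- by move=> x; apply: is_derive_eq; rewrite /F1 /GRing.scale/=; field.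
- by rewrite !expr0n/= !(addr0, mulr0, mul0r) fz subrr.
Qed.

Let g z : R := expR (- (z ^+ 2 / 2)).

Let g_le1 z : g z <= 1.
Proof. by rewrite /g -[leRHS]expR0 ler_expR; have := sqr_ge0 z; lra. Qed.

(** The decay that tames the cubic factor of the third derivative; it comes
    from [1 + z^2 / 4 <= exp (z^2 / 4)] squared. *)
Let g_inv z : (1 + z ^+ 2 / 2 + z ^+ 4 / 16) * g z <= 1.
Proof.
have g0 : 0 < g z := expR_gt0 _.
have -> : 1 + z ^+ 2 / 2 + z ^+ 4 / 16 = (1 + z ^+ 2 / 4) ^+ 2 by field.
have h : 1 + z ^+ 2 / 4 <= expR (z ^+ 2 / 4) := expR_ge1Dx _.
have h0 : 0 <= 1 + z ^+ 2 / 4 by have := sqr_ge0 z; lra.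
have gE : expR (z ^+ 2 / 4) ^+ 2 * g z = 1.
  rewrite /g -expRM_natl -expRD -[RHS]expR0; congr expR; lra.
rewrite -[leRHS]gE ler_pM2r// lerXn2r// nnegrE//; exact: expR_ge0.
Qed.

Let dg z : is_derive z 1 g (- z * g z).
Proof. by rewrite /g; apply: is_derive_eq; rewrite /GRing.scale/=; field. Qed.

Let ddg z : is_derive z 1 (fun z => - z * g z) ((z ^+ 2 - 1) * g z).
Proof.
have := dg z; move: g => h dh.
by apply: is_derive_eq; rewrite /GRing.scale/=; ring.
Qed.

Let dddg z : is_derive z 1 (fun z => (z ^+ 2 - 1) * g z)
  ((3 * z - z ^+ 3) * g z).
Proof.
have := dg z; move: g => h dh.
by apply: is_derive_eq; rewrite /GRing.scale/=; ring.
Qed.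

(** The third derivative is bounded by [12], whence the constant [12 / 6]. *)
Lemma gaussian_taylor z w :
  g (z + w) <= g z - w * z * g z + w ^+ 2 / 2 * (z ^+ 2 - 1) * g z
               + 2 * `|w| ^+ 3.
Proof.

(* The kernel is even, so the reflection of both arguments reduces to
   nonnegative increments. *)
wlog w0 : z w / 0 <= w.
  move=> h; have [/h//|w0] := leP 0 w.
  have := h (- z) (- w); rewrite oppr_ge0 => /(_ (ltW w0)).
  have gN y : g (- y) = g y by rewrite /g sqrrN.
  by rewrite -opprD !gN !sqrrN normrN mulrNN.
rewrite ger0_norm//.
have F3 y : (3 * y - y ^+ 3) * g y <= 12.
  have := g_inv y; have : 0 < g y := expR_gt0 _.
  have : 3 * y - y ^+ 3 <= 12 * (1 + y ^+ 2 / 2 + y ^+ 4 / 16).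
    have := sqr_ge0 (y - 1); have := sqr_ge0 (y * (y + 1)).
    have := sqr_ge0 y; nra.
  move: (g y) (3 * y - _) (1 + _ + _) => p q r qr p0 rp.
  have := ler_wpM2r (ltW p0) qr; lra.
have := taylor3_le z dg ddg dddg F3 w0; lra.
Qed.

(** Up to the factor [sqrt (2 pi)], the density of a centred Gaussian of
    standard deviation [s]. The heat equation runs in the time [s ^+ 2]. *)
Definition heat_kernel s x : R := s^-1 * expR (- ((x / s) ^+ 2 / 2)).

(** Half the second derivative of the kernel in space, hence also its
    derivative in time. *)
Definition heat_kernel2 s x : R :=
  ((x / s) ^+ 2 - 1) / (2 * s ^+ 2) * heat_kernel s x.

Lemma heat_kernel_ge0 s x : 0 < s -> 0 <= heat_kernel s x.
Proof. by move=> s0; rewrite mulr_ge0 ?invr_ge0 ?expR_ge0// ltW. Qed.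

Lemma heat_kernel_le s x : 0 < s -> heat_kernel s x <= s^-1.
Proof.
by move=> s0; rewrite ler_piMr//; [rewrite invr_ge0 ltW|exact: (g_le1 (x / s))].
Qed.

Lemma measurable_heat_kernel s : measurable_fun setT (heat_kernel s).
Proof.
apply: measurable_funM => //; apply: measurableT_comp => //.
apply: measurableT_comp => //; apply: measurable_funM => //.
by apply: measurable_funX; apply: measurable_funM.
Qed.

Lemma heat_kernel_indicator s x : 0 < s -> `|x| < s -> 1 <= 2 * s * heat_kernel s x.
Proof.
move=> s0 xs; rewrite /heat_kernel -mulrA mulVKf ?gt_eqF//.
have h : (x / s) ^+ 2 <= 1.
  rewrite -real_normK ?num_real// expr_le1// normrM normfV (gtr0_norm s0).
  by rewrite ler_pdivrMr// mul1r ltW.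
have := expR_ge1Dx (- ((x / s) ^+ 2 / 2)); lra.
Qed.

(** Averaged over a centred [y], the linear term disappears and the quadratic
    one becomes the Euler step of the heat equation. *)
Lemma heat_kernel_space s x y : 0 < s ->
  heat_kernel s (x + y) <= heat_kernel s x - y * (x / s ^+ 2 * heat_kernel s x)
    + y ^+ 2 * heat_kernel2 s x + 2 / s ^+ 4 * `|y| ^+ 3.
Proof.
move=> s0; have sn : s != 0 by rewrite gt_eqF.
have := gaussian_taylor (x / s) (y / s).
rewrite -mulrDl -(ler_pM2l (_ : 0 < s^-1)) ?invr_gt0// => /le_trans; apply.
rewrite /heat_kernel2 /heat_kernel -/(g _) normrM normfV (gtr0_norm s0).
by rewrite le_eqVlt; apply/orP; left; apply/eqP; field.
Qed.

(** The kernel dominates, to first order in time,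
    the Euler step of the heat equation; this needs only [1 + a <= exp a]. *)
Lemma heat_kernel_time s r t x : 0 < s -> 0 < r -> 0 <= t ->
  r ^+ 2 = s ^+ 2 + t ->
  heat_kernel s x + t * heat_kernel2 s x <= heat_kernel r x + t ^+ 2 / s ^+ 5.
Proof.
move=> s0 r0 t0 rE; have sn : s != 0 by rewrite gt_eqF.
have rn : r != 0 by rewrite gt_eqF.
pose u := t / s ^+ 2; pose z := x / s.
have u0 : 0 <= u by rewrite divr_ge0// exprn_ge0// ltW.
have tE : t = u * s ^+ 2 by rewrite /u mulfVK// expf_neq0.
have r2 : r ^+ 2 = s ^+ 2 * (1 + u) by rewrite rE tE; ring.
have rs : r <= s * expR (u / 2).
  have r_ge0 := ltW r0; have se0 : 0 <= s * expR (u / 2).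
    by rewrite mulr_ge0 ?expR_ge0// ltW.
  rewrite -(@ler_pXn2r _ 2)// exprMn r2 ler_pM2l ?exprn_gt0// -expRM_natl.
  by rewrite (_ : _ * _ = u) ?expR_ge1Dx//; lra.
have low : s^-1 * expR (- (u / 2)) <= r^-1.
  by rewrite expRN -invfM lef_pV2 ?posrE ?mulr_gt0 ?expR_gt0.
have u1 : 0 < 1 + u by lra.
have xr : (x / r) ^+ 2 = z ^+ 2 / (1 + u).
  by rewrite !exprMn !exprVn r2; field; rewrite sn gt_eqF.
have kr : s^-1 * (g z * (1 + (z ^+ 2 - 1) * u / 2 - z ^+ 2 * u ^+ 2 / 2)) <=
    heat_kernel r x.
  apply: (@le_trans _ _ (s^-1 * expR (- (u / 2)) * expR (- ((x / r) ^+ 2 / 2)))).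
    rewrite -[leRHS]mulrA ler_pM2l ?invr_gt0// -expRD xr.
    have -> : - (u / 2) + - (z ^+ 2 / (1 + u) / 2) =
        - (z ^+ 2 / 2) + (- (u / 2) + z ^+ 2 / 2 * (u / (1 + u))).
      by field; rewrite gt_eqF.
    rewrite expRD ler_pM2l ?expR_gt0//; apply: le_trans (expR_ge1Dx _).
    have uu : u - u ^+ 2 <= u / (1 + u).
      by rewrite ler_pdivlMr//; have := exprn_ge0 3 u0; nra.
    have := ler_wpM2l (_ : 0 <= z ^+ 2 / 2) uu.
    by rewrite divr_ge0 ?sqr_ge0// => /(_ isT); lra.
  by rewrite ler_wpM2r ?expR_ge0.
have gz : z ^+ 2 / 2 * g z <= 1.
  apply: le_trans (g_inv z); rewrite ler_wpM2r ?expR_ge0//.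
  have := sqr_ge0 (z ^+ 2); lra.
rewrite -lerBlDr; apply: le_trans kr.
have -> : heat_kernel s x + t * heat_kernel2 s x - t ^+ 2 / s ^+ 5 =
    s^-1 * (g z * (1 + (z ^+ 2 - 1) * u / 2) - u ^+ 2).
  by rewrite /heat_kernel2 /heat_kernel -/z -/(g z) tE; field.
rewrite ler_pM2l ?invr_gt0//.
have := ler_wpM2l (sqr_ge0 u) gz; lra.
Qed.

End gaussian_kernel.

Section concentration.
Context d (T : measurableType d) (R : realType) (Q : probability T R).

(** Lindeberg's replacement, with the heat flow in place of Gaussian summands:
    integrating out one summand costs [heat_kernel_space], and the resulting
    Euler step is absorbed by [heat_kernel_time] into a kernel whose squared
    width has grown by the variance [t]. *)
Lemma heat_kernel_iid (f : T -> R) t b s : 0 < s ->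
  has_mean Q f 0 -> has_mean Q (fun x => f x ^+ 2) t ->
  has_mean Q (fun x => `|f x| ^+ 3) b ->
  forall k c,
  (\int[iid Q k]_w (heat_kernel s (c + \sum_(i < k) f (tnth w i)))%:E <=
   (heat_kernel (Num.sqrt (s ^+ 2 + k%:R * t)) c
    + k%:R * (2 / s ^+ 4 * b + t ^+ 2 / s ^+ 5))%:E)%E.
Proof.
move=> s0 f0 ft fb.
have t0 : 0 <= t by apply: has_mean_ge0 ft => x; exact: sqr_ge0.
have b0 : 0 <= b by apply: has_mean_ge0 fb => x; exact: exprn_ge0.
have mf := has_mean_measurable f0.
set e := 2 / s ^+ 4 * b + t ^+ 2 / s ^+ 5.
elim=> [|k IH] c.
  rewrite !mul0r !addr0 sqrtr_sqr gtr0_norm//.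
  under eq_integral do rewrite big_ord0 addr0.
  by rewrite (has_mean_cst _ _).2.
pose r := Num.sqrt (s ^+ 2 + k%:R * t).
have s2 : 0 < s ^+ 2 by rewrite exprn_gt0.
have kt0 j : 0 <= j%:R * t by rewrite mulr_ge0.
have r0 : 0 < r by rewrite sqrtr_gt0 ltr_pwDl.
have sr : s <= r.
  have sge := ltW s0; have rge := ltW r0.
  by rewrite -(@ler_pXn2r _ 2)// sqr_sqrtr ?lerDl// addr_ge0// ltW.
have mk j c' : measurable_fun setT (fun w : j.-tuple T =>
    heat_kernel s (c' + \sum_(i < j) f (tnth w i))).
  apply: measurableT_comp; first exact: measurable_heat_kernel.
  by apply: measurable_funD => //; exact: (measurable_sum_tnth (f := fun=> f)).
have k0 x : 0 <= heat_kernel s x by exact: heat_kernel_ge0.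
rewrite ge0_integral_distribution; last 2 first.
- by apply/measurable_EFinP; exact: mk.
- by move=> y; rewrite lee_fin.
have mF : measurable_fun setT ((fun w : k.+1.-tuple T =>
    (heat_kernel s (c + \sum_(i < k.+1) f (tnth w i)))%:E) \o @tuple_cons d T k).
  by apply: measurableT_comp => //; apply/measurable_EFinP; exact: mk.
rewrite fubini_tonelli1//=; last by move=> y; rewrite lee_fin.
pose D x := x / r ^+ 2 * heat_kernel r x.
have hm : has_mean Q (fun x => heat_kernel r c - f x * D c
    + f x ^+ 2 * heat_kernel2 r c + 2 / r ^+ 4 * `|f x| ^+ 3 + k%:R * e)
    (heat_kernel r c - D c * 0 + heat_kernel2 r c * t + 2 / r ^+ 4 * b + k%:R * e).
  have := has_meanD (has_meanD (has_meanD (has_meanB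
    (has_mean_cst Q (heat_kernel r c)) (has_meanZ (D c) f0))
    (has_meanZ (heat_kernel2 r c) ft)) (has_meanZ (2 / r ^+ 4) fb))
    (has_mean_cst Q (k%:R * e)).
  apply: eq_has_mean => x /=; ring.
apply: (@le_trans _ _ (\int[Q]_x (heat_kernel r c - f x * D c
    + f x ^+ 2 * heat_kernel2 r c + 2 / r ^+ 4 * `|f x| ^+ 3 + k%:R * e)%:E)%E).
  have step x : (fubini_F (iid Q k) ((fun w : k.+1.-tuple T =>
    (heat_kernel s (c + \sum_(i < k.+1) f (tnth w i)))%:E) \o @tuple_cons d T k) x
      <= (heat_kernel r (c + f x) + k%:R * e)%:E)%E.
    apply: le_trans (IH (c + f x)); rewrite /fubini_F/=.
    rewrite le_eqVlt; apply/orP; left; apply/eqP; apply: eq_integral => w _.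
    rewrite big_ord_recl addrA; congr (heat_kernel _ (_ + _))%:E.
    by apply: eq_bigr => i _; rewrite tnthS.
  apply: ge0_le_integral => //.
  - move=> x _; apply: integral_ge0 => w _; by rewrite lee_fin.
  - by apply: measurable_fun_fubini_tonelli_F => // y; rewrite lee_fin.
  - by apply/measurable_EFinP; exact: has_mean_measurable hm.
  - move=> x _; apply: le_trans (step x) _; rewrite lee_fin lerD2r.
    exact: heat_kernel_space.
have [_ ->] := hm; rewrite lee_fin mulr0 subr0.
have rE : (Num.sqrt (s ^+ 2 + k.+1%:R * t)) ^+ 2 = r ^+ 2 + t.
  rewrite !sqr_sqrtr ?addr_ge0 ?(ltW s2)// -natr1; ring.
have r'0 : 0 < Num.sqrt (s ^+ 2 + k.+1%:R * t).
  by rewrite sqrtr_gt0 ltr_pwDl.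
have := heat_kernel_time c r0 r'0 t0 rE.
have e1 : 2 / r ^+ 4 * b <= 2 / s ^+ 4 * b.
  by rewrite ler_wpM2r// ler_pM2l// lef_pV2 ?posrE ?exprn_gt0// lerXn2r// nnegrE ltW.
have e2 : t ^+ 2 / r ^+ 5 <= t ^+ 2 / s ^+ 5.
  by rewrite ler_wpM2l ?sqr_ge0// lef_pV2 ?posrE ?exprn_gt0// lerXn2r// nnegrE ltW.
have ee : 2 / r ^+ 4 * b + t ^+ 2 / r ^+ 5 <= e by rewrite lerD.
have -> : k.+1%:R * e = k%:R * e + e by rewrite -natr1 mulrDl mul1r.
lra.
Qed.

(** The kernel of width [s], rescaled to height [2], dominates the indicator of
    an interval of radius [s]. Once the heat flow has run for unit time, its
    height is at most [2 * s] wherever it is centred, which is why [c] is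
    arbitrary. *)
Lemma concentration_normalized_sum (f : T -> R) b k c s : (0 < k)%N -> 0 < s ->
  has_mean Q f 0 -> has_mean Q (fun x => f x ^+ 2) 1 ->
  has_mean Q (fun x => `|f x ^+ 3|) b ->
  (iid Q k [set w | (`|(Num.sqrt k%:R)^-1 * (\sum_(i < k) f (tnth w i)) - c| < s)%R] <=
   (2 * s + 4 * (b * (Num.sqrt k%:R)^-1) / s ^+ 3 + 2 * k%:R^-1 / s ^+ 4)%:E)%E.
Proof.
move=> k0 s0 f0 f1 fb; set q := (Num.sqrt k%:R)^-1.
have kR : 0 < k%:R :> R by rewrite ltr0n.
have q0 : 0 < q by rewrite invr_gt0 sqrtr_gt0.
have q2 : q ^+ 2 = k%:R^-1 by rewrite exprVn sqr_sqrtr// ltW.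
have mf := has_mean_measurable f0.
have g0 : has_mean Q (fun x => q * f x) 0.
  by rewrite -(mulr0 q); exact: has_meanZ.
have g1 : has_mean Q (fun x => (q * f x) ^+ 2) k%:R^-1.
  rewrite -q2 -[X in has_mean _ _ X]mulr1.
  by apply: eq_has_mean (has_meanZ (q ^+ 2) f1) => x /=; rewrite exprMn.
have gb : has_mean Q (fun x => `|q * f x| ^+ 3) (q ^+ 3 * b).
  apply: eq_has_mean (has_meanZ (q ^+ 3) fb) => x /=.
  by rewrite normrX normrM exprMn (gtr0_norm q0).
have := heat_kernel_iid s0 g0 g1 gb k (- c).
have mh : measurable_fun setT (fun w : k.-tuple T =>
    heat_kernel s (- c + \sum_(i < k) q * f (tnth w i))).
  apply: measurableT_comp; first exact: measurable_heat_kernel.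
  apply: measurable_funD => //.
  by apply: (measurable_sum_tnth (f := fun i x => q * f x)) => i; exact: measurable_funM.
set A := [set w | _].
have mN : measurable_fun setT (fun w : k.-tuple T =>
    `|q * (\sum_(i < k) f (tnth w i)) - c|).
  apply: measurableT_comp => //; apply: measurable_funB => //.
  apply: measurable_funM => //.
  by apply: (measurable_sum_tnth (f := fun i x => f x)).
have mA : measurable A.
  rewrite (_ : A = setT `&` (fun w : k.-tuple T =>
      `|q * (\sum_(i < k) f (tnth w i)) - c|) @^-1` `]-oo, s[); first exact: mN.
  by apply/seteqP; split=> [w|w []]; rewrite /A/= in_itv.
have -> : iid Q k A = (\int[iid Q k]_w (\1_A w)%:E)%E.
  by rewrite integral_indic// setIT.
move=> H; apply: (@le_trans _ _ (\int[iid Q k]_w ((2 * s)%:E *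
    (heat_kernel s (- c + \sum_(i < k) q * f (tnth w i)))%:E))%E).
  apply: ge0_le_integral => //.
  - exact/measurable_EFinP/measurable_indic.
  - by apply/measurable_EFinP; apply: measurable_funM.
  - move=> w _; rewrite -EFinM lee_fin indicE; have [/set_mem wA|_] := boolP (w \in A).
      apply: heat_kernel_indicator => //.
      by rewrite addrC -mulr_sumr; exact: wA.
    by rewrite mulr_ge0 ?heat_kernel_ge0// mulr_ge0// ltW.
rewrite ge0_integralZl//; last 3 first.
- exact/measurable_EFinP.
- by move=> w _; rewrite lee_fin heat_kernel_ge0.
- by rewrite lee_fin mulr_ge0// ltW.
apply: le_trans (lee_wpmul2l _ H) _; first by rewrite lee_fin mulr_ge0// ltW.
rewrite -EFinM lee_fin mulrDr mulfV ?gt_eqF//.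
have r1 : heat_kernel (Num.sqrt (s ^+ 2 + 1)) (- c) <= 1.
  have s1 : 1 <= Num.sqrt (s ^+ 2 + 1).
    by rewrite -[leLHS]sqrtr1 ler_wsqrtr// lerDr sqr_ge0.
  have s'0 := lt_le_trans ltr01 s1.
  by apply: le_trans (heat_kernel_le _ s'0) _; rewrite invf_le1.
have sn : s != 0 by rewrite gt_eqF.
have kE : k%:R * q ^+ 2 = 1 by rewrite q2 mulfV ?gt_eqF.
rewrite -addrA lerD//; first by rewrite ler_piMr// mulr_ge0// ltW.
rewrite -q2 le_eqVlt; apply/orP; left; apply/eqP.
transitivity (k%:R * q ^+ 2 * (4 * (b * q) / s ^+ 3 + 2 * q ^+ 2 / s ^+ 4)).
  by field.
by rewrite kE mul1r.
Qed.

End concentration.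

(** * The singular value expansion and the maximal correlation *)

Section spectral.
Local Open Scope charge_scope.
Context d1 d2 (X : measurableType d1) (Y : measurableType d2) (R : realType).
Variable P : probability (X * Y)%type R.
Hypothesis chi2_fin : (chi2_information P < +oo)%E.

Local Notation Q := (product_marginals P).
Local Notation L := (likelihood_ratio P).

Lemma square_integrable_prod (g : X -> R) (h : Y -> R) :
  square_integrable (marginalX P) g -> square_integrable (marginalY P) h ->
  square_integrable Q (fun w => g w.1 * h w.2).
Proof.
move=> sg sh; split.
  by apply: measurable_funM; apply: measurableT_comp => //; [case: sg|case: sh].
have [+ _] := has_mean_prod (integrable_has_mean sg.2) (integrable_has_mean sh.2).
by apply: eq_integrable => // w _ /=; rewrite exprMn.
Qed.

Lemma dominated_product_marginals : (P `<< Q)%classic.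
Proof.
by move: chi2_fin; rewrite /chi2_information /chi2; case: ifPn => // /asboolP.
Qed.

Lemma likelihood_ratioE w :
  (L w)%:E = ('d (charge_of_finite_measure P) '/d Q w).
Proof.
rewrite /likelihood_ratio fineK//; apply: Radon_Nikodym_fin_num.
exact: dominated_product_marginals.
Qed.

Lemma square_integrable_likelihood_ratio : square_integrable Q L.
Proof.
have mL : measurable_fun setT L.
  apply/measurable_EFinP; rewrite (_ : _ \o _ =
    ('d (charge_of_finite_measure P) '/d Q)).
    apply: measurable_int; apply: Radon_Nikodym_integrable.
    exact: dominated_product_marginals.
  by apply/funext => w; rewrite /= likelihood_ratioE.
have sL1 : square_integrable Q (fun w => L w - 1).
  have mL1 : measurable_fun setT (fun w => L w - 1) by exact: measurable_funB.
  split => //; apply/integrableP; split.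
    by apply/measurable_EFinP; exact: measurable_funX.
  move: chi2_fin; rewrite /chi2_information /chi2.
  rewrite asboolT; last exact: dominated_product_marginals.
  congr (_ < _)%E; apply: eq_integral => w _.
  by rewrite -likelihood_ratioE -EFinB -EFin_expe /= ger0_norm ?sqr_ge0.
have := square_integrableD sL1 (square_integrable_cst Q 1).
by under eq_fun do rewrite subrK.
Qed.

Lemma has_mean_likelihood_ratio (W : X * Y -> R) a :
  has_mean P W a -> measurable_fun setT W -> square_integrable Q W ->
  has_mean Q (fun w => W w * L w) a.
Proof.
move=> [Wi Wa] mW sW.
have [WLi _] := square_integrable_mul sW square_integrable_likelihood_ratio.
split => //; rewrite -Wa -(Radon_Nikodym_change_of_variables
  dominated_product_marginals measurableT Wi).
by apply: eq_integral => w _; rewrite EFinM likelihood_ratioE.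
Qed.

Variables (lambda : nat -> R) (phi : nat -> X -> R) (psi : nat -> Y -> R).
Hypothesis dec : spectral_decomposition P lambda phi psi.

Let sphi k : square_integrable (marginalX P) (phi k).
Proof. by have [_ [h _] _ _ _] := dec; exact: Lfun2_square_integrable. Qed.

Let spsi k : square_integrable (marginalY P) (psi k).
Proof. by have [_ _ [h _] _ _] := dec; exact: Lfun2_square_integrable. Qed.

Lemma phi_orthonormal j k : 0 < lambda j -> 0 < lambda k ->
  has_mean (marginalX P) (fun x => phi j x * phi k x) (j == k)%:R.
Proof.
have [_ [_ h] _ _ _] := dec => lj lk; apply: has_mean_expectation (h _ _ lj lk).
by have [] := square_integrable_mul (sphi j) (sphi k).
Qed.

Lemma psi_orthonormal j k : 0 < lambda j -> 0 < lambda k ->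
  has_mean (marginalY P) (fun x => psi j x * psi k x) (j == k)%:R.
Proof.
have [_ _ [_ h] _ _] := dec => lj lk; apply: has_mean_expectation (h _ _ lj lk).
by have [] := square_integrable_mul (spsi j) (spsi k).
Qed.

Lemma lambda_ge0 k : 0 <= lambda k.
Proof.
have [[l0 l] _ _ _ _] := dec.
by case: k => [|k]; [rewrite l0|have /andP[] := l k].
Qed.

Lemma lambda_le1 k : (0 < k)%N -> lambda k <= lambda 1%N.
Proof.
have [[l0 l] _ _ _ _] := dec.
case: k => // + _; elim=> // k IH; apply: le_trans IH.
by have /andP[] := l k.+1.
Qed.

(** The expansion converges in [L_2], hence weakly: its bilinear form converges
    to the correlation under the joint law. *)
Lemma spectral_correlation (g : X -> R) (h : Y -> R) (a b : nat -> R) c :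
  square_integrable (marginalX P) g -> square_integrable (marginalY P) h ->
  (forall k, has_mean (marginalX P) (fun x => g x * phi k x) (a k)) ->
  (forall k, has_mean (marginalY P) (fun y => h y * psi k y) (b k)) ->
  has_mean P (fun w => g w.1 * h w.2) c ->
  \sum_(0 <= k < N) lambda k * (a k * b k) @[N --> \oo] --> c.
Proof.
move=> sg sh ga hb Pc; pose W (w : X * Y) := g w.1 * h w.2.
pose S N (w : X * Y) := \sum_(0 <= k < N) lambda k * phi k w.1 * psi k w.2.
have sW : square_integrable Q W by exact: square_integrable_prod.
have sS N : square_integrable Q (S N).
  apply: square_integrable_sum => k.
  under eq_fun do rewrite -mulrA.
  by apply: square_integrableZ; exact: square_integrable_prod.
have sD N : square_integrable Q (fun w => L w - S N w).
  apply: square_integrableD; first exact: square_integrable_likelihood_ratio.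
  by under eq_fun do rewrite -mulN1r; exact: square_integrableZ.
have WL : has_mean Q (fun w => W w * L w) c.
  by apply: has_mean_likelihood_ratio => //; case: sW.
have WS N : has_mean Q (fun w => W w * S N w)
    (\sum_(0 <= k < N) lambda k * (a k * b k)).
  have := has_mean_sum (index_iota 0 N) xpredT
    (fun k => has_meanZ (lambda k) (has_mean_prod (ga k) (hb k))).
  apply: eq_has_mean => w; rewrite /S mulr_sumr; apply: eq_bigr => k _.
  rewrite /W; ring.
have WW := square_integrable_mul sW sW.
set A := (\int[_]_x _)%R in WW.
have DD N := square_integrable_mul (sD N) (sD N).
set B := fun N => (\int[Q]_x ((L x - S N x) * (L x - S N x)))%R.
have CS N : (c - \sum_(0 <= k < N) lambda k * (a k * b k)) ^+ 2 <= A * B N.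
  apply: has_mean_Cauchy_Schwarz WW (DD N) _.
  by apply: eq_has_mean (has_meanB WL (WS N)) => w; ring.
have B0 : B N @[N --> \oo] --> 0.
  have [_ _ _ _] := dec; move=> /fine_cvgP[_]; apply: cvg_trans.
  by apply: near_eq_cvg; near=> N; rewrite /B /Rintegral.
apply/subr_cvg0/norm_cvg0P.
rewrite (_ : (fun x => _) = fun N =>
    `|c - \sum_(0 <= k < N) lambda k * (a k * b k)|); last first.
  by apply/funext => N; rewrite distrC.
have AB0 : Num.sqrt (A * B N) @[N --> \oo] --> 0.
  rewrite -(@sqrtr0 R); apply: continuous_cvg; first exact: sqrt_continuous.
  by rewrite -(mulr0 A); exact: cvgMl_tmp.
apply: (squeeze_cvgr _ (cvg_cst 0) AB0); apply: nearW => N.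
by rewrite normr_ge0 -sqrtr_sqr ler_wsqrtr.
Unshelve. all: by end_near. Qed.

Let phi0 : {ae marginalX P, forall x, phi 0%N x = 1}.
Proof. by have [_ _ _ [h _] _] := dec. Qed.

Let psi0 : {ae marginalY P, forall y, psi 0%N y = 1}.
Proof. by have [_ _ _ [_ h] _] := dec. Qed.

Let lambda00 : lambda 0%N = 1.
Proof. by have [[h _] _ _ _ _] := dec. Qed.

Lemma phi1_moments : 0 < lambda 1%N ->
  has_mean (marginalX P) (phi 1%N) 0 /\
  has_mean (marginalX P) (fun x => phi 1%N x ^+ 2) 1.
Proof.
move=> l1; split.
  apply/(has_mean_mul_ae1 _ phi0) => //; first by case: (sphi 1%N).
  by apply: phi_orthonormal; rewrite // lambda00.
exact: phi_orthonormal.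
Qed.

Lemma psi1_moments : 0 < lambda 1%N ->
  has_mean (marginalY P) (psi 1%N) 0 /\
  has_mean (marginalY P) (fun x => psi 1%N x ^+ 2) 1.
Proof.
move=> l1; split.
  apply/(has_mean_mul_ae1 _ psi0) => //; first by case: (spsi 1%N).
  by apply: psi_orthonormal; rewrite // lambda00.
exact: psi_orthonormal.
Qed.

Lemma square_integrable_joint (g : X -> R) (h : Y -> R) :
  square_integrable (marginalX P) g -> square_integrable (marginalY P) h ->
  has_mean P (fun w => g w.1 * h w.2) (\int[P]_w (g w.1 * h w.2)).
Proof.
move=> /square_integrable_distribution sg /square_integrable_distribution sh.
exact: square_integrable_mul sg sh.
Qed.

Lemma phi1_psi1_correlation : 0 < lambda 1%N ->
  has_mean P (fun w => phi 1%N w.1 * psi 1%N w.2) (lambda 1%N).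
Proof.
move=> l1; have Pc := square_integrable_joint (sphi 1%N) (spsi 1%N).
have ha k := square_integrable_mul (sphi 1%N) (sphi k).
have hb k := square_integrable_mul (spsi 1%N) (spsi k).
have := spectral_correlation (sphi 1%N) (spsi 1%N) ha hb Pc.
set s := fun N => _; have s1 : s N @[N --> \oo] --> lambda 1%N.
  apply: cvg_near_cst; near=> N.
  have N1 : (1 < N)%N by near: N; exact: nbhs_infty_gt.
  rewrite /s (bigD1_seq 1%N) ?mem_index_iota ?iota_uniq//=.
  rewrite (has_mean_unique (ha 1%N) (phi_orthonormal l1 l1)).
  rewrite (has_mean_unique (hb 1%N) (psi_orthonormal l1 l1)).
  rewrite !mulr1 big1 ?addr0// => k k1.
  have [lk|lk] := ltP 0 (lambda k).
    rewrite (has_mean_unique (ha k) (phi_orthonormal l1 lk)).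
    by rewrite eq_sym (negbTE k1) mul0r mulr0.
  have -> : lambda k = 0 by apply/le_anti; rewrite lk lambda_ge0.
  by rewrite mul0r.
by move=> /(cvg_unique _ s1) E; move: Pc; rewrite -E.
Unshelve. all: by end_near. Qed.

(** Testing against centred [g] and [h] removes the term [k = 0]; the others
    have weight at most [lambda 1], and Bessel bounds their total. *)
Lemma maximal_correlation_le : (maximal_correlation P <= (lambda 1%N)%:E)%E.
Proof.
apply: ge_ereal_sup => _ [g [h [[gL hL] [g0 h0] [g1 h1] ->]]].
have sg := Lfun2_square_integrable gL; have sh := Lfun2_square_integrable hL.
have gm : has_mean (marginalX P) g 0.
  apply: has_mean_expectation g0.
  have [+ _] := square_integrable_mul sg (square_integrable_cst _ 1).
  by apply: eq_integrable => // x _; rewrite /= mulr1.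
have hm : has_mean (marginalY P) h 0.
  apply: has_mean_expectation h0.
  have [+ _] := square_integrable_mul sh (square_integrable_cst _ 1).
  by apply: eq_integrable => // x _; rewrite /= mulr1.
have gg : has_mean (marginalX P) (fun x => g x * g x) 1.
  by apply: has_mean_expectation g1; case: sg.
have hh : has_mean (marginalY P) (fun x => h x * h x) 1.
  by apply: has_mean_expectation h1; case: sh.
pose a k := \int[marginalX P]_x (g x * phi k x).
pose b k := \int[marginalY P]_y (h y * psi k y).
have ha k : has_mean (marginalX P) (fun x => g x * phi k x) (a k).
  exact: square_integrable_mul.
have hb k : has_mean (marginalY P) (fun y => h y * psi k y) (b k).
  exact: square_integrable_mul.
have Pc := square_integrable_joint sg sh.
rewrite unlock; have [_ ->] := Pc; rewrite lee_fin.
have := spectral_correlation sg sh ha hb Pc.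
move=> /cvgr_to_le; apply; apply: nearW => N.
have a0 : a 0%N = 0.
  exact: has_mean_unique (ha 0%N) ((has_mean_mul_ae1 0 phi0 (sphi 0%N) sg.1).1 gm).
(* Orthonormality is available only where the singular value is positive; the
   remaining terms of the expansion vanish. *)
pose s := [seq k <- index_iota 0 N | (0 < lambda k) && (0 < k)%N].
have us : uniq s by rewrite filter_uniq// iota_uniq.
have inS k : k \in s -> 0 < lambda k.
  by rewrite mem_filter => /andP[/andP[]].
have Ba := Bessel us sphi sg (fun j k js ks => phi_orthonormal (inS j js) (inS k ks))
  (fun k _ => ha k) gg.
have Bb := Bessel us spsi sh (fun j k js ks => psi_orthonormal (inS j js) (inS k ks))
  (fun k _ => hb k) hh.
have l1 := lambda_ge0 1.
apply: (@le_trans _ _ (\sum_(k <- s) lambda 1%N * ((a k ^+ 2 + b k ^+ 2) / 2))).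
  rewrite big_filter [leRHS]big_mkcond/=; apply: ler_sum => k _.
  case: ifPn => [/andP[lk k0]|].
    have ab : a k * b k <= (a k ^+ 2 + b k ^+ 2) / 2.
      by have := sqr_ge0 (a k - b k); lra.
    have ab0 : 0 <= (a k ^+ 2 + b k ^+ 2) / 2.
      by rewrite divr_ge0// addr_ge0// sqr_ge0.
    apply: le_trans (ler_wpM2l (ltW lk) ab) _.
    by apply: ler_wpM2r => //; exact: lambda_le1.
  rewrite negb_and -leNgt => /orP[lk|].
    have -> : lambda k = 0 by apply/le_anti; rewrite lk lambda_ge0.
    by rewrite mul0r.
  by rewrite -leqNgt leqn0 => /eqP ->; rewrite a0 mul0r mulr0.
rewrite -mulr_sumr -mulr_suml big_split/= ler_piMr//; lra.
Qed.

End spectral.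

(** * The two hypotheses *)

Section measure_bounds.
Context d1 d2 (T1 : measurableType d1) (T2 : measurableType d2) (R : realType).

Lemma Markov_has_mean (Q : probability T1 R) (f : T1 -> R) e t :
  0 < t -> (forall x, 0 <= f x) -> has_mean Q f e ->
  (Q (~` [set x | (f x < t)%R]) <= (e / t)%:E)%E.
Proof.
move=> t0 f0 fe; have mf := has_mean_measurable fe.
set A := ~` _; have mA : measurable A.
  rewrite (_ : A = setT `&` f @^-1` `[t, +oo[); first exact: mf.
  by apply/seteqP; split=> [x /negP|x [_]]; rewrite /= in_itv/= andbT leNgt // => /negP.
have -> : Q A = (\int[Q]_x (\1_A x)%:E)%E by rewrite integral_indic// setIT.
have [_] := has_meanZ t^-1 fe; rewrite mulrC => <-.
apply: ge0_le_integral => //.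
- exact/measurable_EFinP/measurable_indic.
- by apply/measurable_EFinP; exact: measurable_funM.
- move=> x _; rewrite lee_fin indicE; have [/set_mem/= xA|_] := boolP (x \in A).
    by rewrite mulrC ler_pdivlMr// mul1r leNgt; exact/negP.
  by rewrite mulr_ge0// invr_ge0 ltW.
Qed.

Variables (Q1 : probability T1 R) (Q2 : probability T2 R) (A : set (T1 * T2)).
Variable b : R.
Hypothesis mA : measurable A.

Lemma product_measure_le_xsection :
  (forall x, Q2 [set y | A (x, y)] <= b%:E)%E -> ((Q1 \x Q2) A <= b%:E)%E.
Proof.
move=> Ab.
have -> : (Q1 \x Q2)%E A = (\int[Q1 \x Q2]_x (\1_A x)%:E)%E.
  by rewrite integral_indic// setIT.
have m1 : measurable_fun setT (fun x : T1 * T2 => (\1_A x)%:E : \bar R).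
  exact/measurable_EFinP/measurable_indic.
rewrite fubini_tonelli1//=.
have [_ <-] := has_mean_cst Q1 b; apply: ge0_le_integral => //.
- by move=> x _; apply: integral_ge0 => y _; rewrite lee_fin.
- by apply: measurable_fun_fubini_tonelli_F => // x; rewrite lee_fin.
- by apply/measurable_EFinP; exact: measurable_cst.
- move=> x _; apply: le_trans (Ab x); rewrite /fubini_F.
  have mx : measurable [set y | A (x, y)].
    by have := measurable_xsection x mA; rewrite xsectionE.
  rewrite le_eqVlt; apply/orP; left; apply/eqP.
  transitivity (\int[Q2]_y (\1_[set y | A (x, y)] y)%:E)%E; last first.
    by rewrite integral_indic// setIT.
  by apply: eq_integral => y _; rewrite !indicE; congr (_%:R)%:E;
    apply/idP/idP; rewrite !inE.
Qed.

Lemma product_measure_le_ysection :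
  (forall y, Q1 [set x | A (x, y)] <= b%:E)%E -> ((Q1 \x Q2) A <= b%:E)%E.
Proof.
move=> Ab.
have -> : (Q1 \x Q2)%E A = (\int[Q1 \x Q2]_x (\1_A x)%:E)%E.
  by rewrite integral_indic// setIT.
have m1 : measurable_fun setT (fun x : T1 * T2 => (\1_A x)%:E : \bar R).
  exact/measurable_EFinP/measurable_indic.
rewrite fubini_tonelli2//=.
have [_ <-] := has_mean_cst Q2 b; apply: ge0_le_integral => //.
- by move=> x _; apply: integral_ge0 => y _; rewrite lee_fin.
- by apply: measurable_fun_fubini_tonelli_G => // x; rewrite lee_fin.
- by apply/measurable_EFinP; exact: measurable_cst.
- move=> y _; apply: le_trans (Ab y); rewrite /fubini_G.
  have mx : measurable [set x | A (x, y)].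
    by have := measurable_ysection y mA; rewrite ysectionE.
  rewrite le_eqVlt; apply/orP; left; apply/eqP.
  transitivity (\int[Q1]_x (\1_[set x | A (x, y)] x)%:E)%E; last first.
    by rewrite integral_indic// setIT.
  by apply: eq_integral => x _; rewrite !indicE; congr (_%:R)%:E;
    apply/idP/idP; rewrite !inE.
Qed.

End measure_bounds.

Section statistic.
Context d1 d2 (X : measurableType d1) (Y : measurableType d2) (R : realType).
Variable P : probability (X * Y)%type R.
Variables (phi : X -> R) (psi : Y -> R).
Hypotheses (phi0 : has_mean (marginalX P) phi 0)
  (phi1 : has_mean (marginalX P) (fun x => phi x ^+ 2) 1)
  (psi0 : has_mean (marginalY P) psi 0)
  (psi1 : has_mean (marginalY P) (fun y => psi y ^+ 2) 1).
Variables n m : nat.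
Hypotheses (m0 : (0 < m)%N) (mn : (m <= n)%N).

Let p : R := (Num.sqrt n%:R)^-1.
Let r : R := (Num.sqrt m%:R)^-1.

Let mphi : measurable_fun setT phi := has_mean_measurable phi0.
Let mpsi : measurable_fun setT psi := has_mean_measurable psi0.

Lemma measurable_T_top : measurable_fun setT (@T_top d1 d2 X Y R n m phi psi).
Proof.
apply: measurable_funX; apply: measurable_funB; apply: measurable_funM => //.
- apply: (@measurableT_comp _ _ _ _ _ _ (fun x : n.-tuple X =>
    \sum_(i < n) phi (tnth x i))) => //.
  exact: (measurable_sum_tnth (f := fun=> phi)).
- apply: (@measurableT_comp _ _ _ _ _ _ (fun y : m.-tuple Y =>
    \sum_(i < m) psi (tnth y i))) => //.
  exact: (measurable_sum_tnth (f := fun=> psi)).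
Qed.

Lemma T_top_ltE s (w : n.-tuple X * m.-tuple Y) : 0 < s ->
  (T_top phi psi w < s ^+ 2) =
  (`|p * (\sum_(i < n) phi (tnth w.1 i)) - r * (\sum_(i < m) psi (tnth w.2 i))| < s).
Proof.
move=> s0; rewrite /T_top -/p -/r -real_normK ?num_real//.
by rewrite ltr_pXn2r// nnegrE ltW.
Qed.

Let measurable_rejection t : measurable
  [set w : n.-tuple X * m.-tuple Y | T_top phi psi w < t].
Proof.
rewrite (_ : [set w | _] = setT `&` (T_top phi psi) @^-1` `]-oo, t[).
  exact: measurable_T_top.
by apply/seteqP; split=> [w|w []]; rewrite /= in_itv.
Qed.

Lemma null_law_le_X b s :
  has_mean (marginalX P) (fun x => `|phi x ^+ 3|) b -> 0 < s ->
  (null_law P n m [set w | (T_top phi psi w < s ^+ 2)%R] <=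
   (2 * s + 4 * (b * p) / s ^+ 3 + 2 * n%:R^-1 / s ^+ 4)%:E)%E.
Proof.
move=> hb s0; apply: product_measure_le_ysection; first exact: measurable_rejection.
move=> y; rewrite (_ : [set x | _] = [set x | `|p * (\sum_(i < n) phi (tnth x i))
    - r * (\sum_(i < m) psi (tnth y i))| < s]).
  by apply: concentration_normalized_sum => //; exact: leq_trans mn.
by apply/seteqP; split => x; rewrite /= T_top_ltE.
Qed.

Lemma null_law_le_Y b s :
  has_mean (marginalY P) (fun y => `|psi y ^+ 3|) b -> 0 < s ->
  (null_law P n m [set w | (T_top phi psi w < s ^+ 2)%R] <=
   (2 * s + 4 * (b * r) / s ^+ 3 + 2 * m%:R^-1 / s ^+ 4)%:E)%E.
Proof.
move=> hb s0; apply: product_measure_le_xsection; first exact: measurable_rejection.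
move=> x; rewrite (_ : [set y | _] = [set y | `|r * (\sum_(i < m) psi (tnth y i))
    - p * (\sum_(i < n) phi (tnth x i))| < s]).
  exact: concentration_normalized_sum.
by apply/seteqP; split => y; rewrite /= T_top_ltE// distrC.
Qed.

Variable rho : R.
Hypothesis cor : has_mean P (fun w => phi w.1 * psi w.2) rho.

(** Regrouping by the image of [pi] exposes the independence: the first sum
    depends on the [m] planted pairs only, the second on the fresh sample. *)
Lemma sum_plant (pi : {ffun 'I_m -> 'I_n}) (s : m.-tuple (X * Y) * n.-tuple X) :
  injective pi ->
  \sum_(j < n) phi (tnth (plant pi s).1 j) =
  \sum_(i < m) phi (tnth s.1 i).1 +
  \sum_(j < n) (if j \in codom pi then 0 else phi (tnth s.2 j)).
Proof.
move=> pi_inj; under eq_bigr do rewrite tnth_mktuple.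
rewrite (bigID (mem (codom pi)))/=; congr (_ + _).
  rewrite (eq_bigl (fun j => j \in [set pi i | i in [set: 'I_m]]%SET)); last first.
    move=> j; apply/codomP/imsetP => [[i ->]|[i _ ->]]; by exists i; rewrite ?inE.
  rewrite big_imset/=; last by move=> i j _ _; exact: pi_inj.
  rewrite big_mkcond; apply: eq_bigr => i _; rewrite inE.
  case: pickP => [j /eqP/pi_inj -> //|/(_ i)].
  by rewrite eqxx.
rewrite [LHS]big_mkcond; apply: eq_bigr => j _.
rewrite if_neg; case: ifPn => // jpi; case: pickP => // i /eqP ij.
by rewrite -ij codom_f in jpi.
Qed.

(** The [m] pairs have variance [1/n + 1/m - 2 rho / sqrt (n m)] each and the
    [n - m] unmatched points [1/n] each, for every injection alike. *)
Lemma has_mean_planted_T_top (pi : {ffun 'I_m -> 'I_n}) : injective pi ->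
  has_mean (conditional_law P pi) (T_top phi psi)
    (2 - 2 * (Num.sqrt (m%:R / n%:R) * rho)).
Proof.
move=> pi_inj; apply/has_mean_distribution; first exact: measurable_T_top.
have n0 : (0 < n)%N by exact: leq_trans mn.
have nR : n%:R != 0 :> R by rewrite pnatr_eq0 -lt0n.
have mR : m%:R != 0 :> R by rewrite pnatr_eq0 -lt0n.
have p2 : p ^+ 2 = n%:R^-1 by rewrite exprVn sqr_sqrtr.
have r2 : r ^+ 2 = m%:R^-1 by rewrite exprVn sqr_sqrtr.
pose F (w : X * Y) := p * phi w.1 - r * psi w.2.
pose G (j : 'I_n) (x : X) := if j \in codom pi then 0 else p * phi x.
have phiP := (has_mean_distribution _ _ _ mphi).1 phi0.
have psiP := (has_mean_distribution _ _ _ mpsi).1 psi0.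
have phi1P := (has_mean_distribution _ _ _ (measurable_funX 2 mphi)).1 phi1.
have psi1P := (has_mean_distribution _ _ _ (measurable_funX 2 mpsi)).1 psi1.
have F0 : has_mean P F 0.
  have := has_meanB (has_meanZ p phiP) (has_meanZ r psiP).
  by rewrite !mulr0 subr0.
have F2 : has_mean P (fun w => F w ^+ 2) (p ^+ 2 - 2 * (p * r) * rho + r ^+ 2).
  have := has_meanD (has_meanB (has_meanZ (p ^+ 2) phi1P)
    (has_meanZ (2 * (p * r)) cor)) (has_meanZ (r ^+ 2) psi1P).
  rewrite !mulr1; apply: eq_has_mean => w; rewrite /F /=; ring.
have G0 j : has_mean (marginalX P) (G j) 0.
  rewrite /G; case: (j \in codom pi); first exact: has_mean_cst.
  by have := has_meanZ p phi0; rewrite mulr0.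
have G2 j : has_mean (marginalX P) (fun x => G j x ^+ 2)
    (if j \in codom pi then 0 else p ^+ 2).
  rewrite /G; case: (j \in codom pi).
    by apply: eq_has_mean (has_mean_cst _ 0) => x; rewrite expr0n.
  have := has_meanZ (p ^+ 2) phi1; rewrite mulr1.
  by apply: eq_has_mean => x; rewrite exprMn.
have [U0 U2] := variance_iid (f := fun _ : 'I_m => F) (fun=> F0) (fun=> F2).
have [V0 V2] := variance_iid G0 G2.
have [_] := variance_prod U0 U2 V0 V2.
rewrite (_ : _ + _ = 2 - 2 * (Num.sqrt (m%:R / n%:R) * rho)).
  apply: eq_has_mean => s; rewrite /T_top [in RHS]/= sum_plant// -/p -/r.
  congr (_ ^+ 2); rewrite /F sumrB -!mulr_sumr mulrDr addrAC; congr (_ + _ - _).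
    rewrite mulr_sumr; apply: eq_bigr => j _.
    by rewrite /G; case: (j \in codom pi); rewrite ?mulr0.
  by congr (_ * _); apply: eq_bigr => i _; rewrite tnth_mktuple.
rewrite sumr_const card_ord -mulr_natl.
under [X in _ + X]eq_bigr do rewrite -if_neg.
rewrite -big_mkcond sumr_const.
have -> : #|[pred j | j \notin codom pi]| = (n - m)%N.
  have := cardC (mem (codom pi)); rewrite card_codom// !card_ord.
  move=> /(congr1 (subn^~ m)); rewrite addKn => <-.
  by apply: eq_card => j; rewrite !inE.
rewrite -[_ *+ (n - m)]mulr_natl natrB// p2 r2.
have -> : Num.sqrt (m%:R / n%:R) = m%:R * (p * r).
  rewrite sqrtrM// sqrtrV// -/p [RHS]mulrCA mulrC; congr (_ * _).
  by rewrite /r -[X in X / _](@sqr_sqrtr _ m%:R)// expr2 mulfK// sqrtr_eq0 -ltNge ltr0n.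
by field; rewrite nR mR.
Qed.

Lemma planted_law_le t e : 0 < t -> 0 <= e ->
  2 - 2 * (Num.sqrt (m%:R / n%:R) * rho) <= e ->
  (planted_law P n m (~` [set w | (T_top phi psi w < t)%R]) <= (e / t)%:E)%E.
Proof.
move=> t0 e0 he; rewrite /planted_law.
have et : 0 <= e / t by rewrite divr_ge0// ltW.
have step pi : pi \in @injections n m ->
    (conditional_law P pi (~` [set w | (T_top phi psi w < t)%R]) <= (e / t)%:E)%E.
  move=> /injectiveP pi_inj.
  apply: le_trans (Markov_has_mean t0 _ (has_mean_planted_T_top pi_inj)) _.
    by move=> w; exact: sqr_ge0.
  by rewrite lee_fin ler_wpM2r// invr_ge0 ltW.
apply: le_trans (lee_wpmul2l _ (lee_sum _ step)) _.
  by rewrite lee_fin invr_ge0.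
rewrite sumEFin -EFinM lee_fin sumr_const -[e / t *+ _]mulr_natl [leLHS]mulrA.
have [->|c0] := eqVneq (#|@injections n m|%:R : R) 0; first by rewrite mulr0 mul0r.
by rewrite mulVf// mul1r.
Qed.

End statistic.

(** * Choice of the threshold *)

Section asymptotics.
Variable R : realType.

(** With [q] dominating all error terms, the radius [q ^ (1/8)] tends to [0],
    while [q] is negligible against the fourth power of that radius. *)
Lemma strong_detection_of_rates (Omega : nat -> Type)
    (H0 H1 : forall n, set (Omega n) -> \bar R) (T : forall n, Omega n -> R)
    (beta kappa eps : nat -> R) :
  beta @ \oo --> 0 -> kappa @ \oo --> 0 -> eps @ \oo --> 0 ->
  (forall n A, (0 <= H0 n A)%E) -> (forall n A, (0 <= H1 n A)%E) ->
  (\forall n \near \oo, forall s : R, 0 < s ->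
    (H0 n [set w | (T n w < s ^+ 2)%R] <=
     (2 * s + 4 * beta n / s ^+ 3 + 2 * kappa n / s ^+ 4)%:E)%E) ->
  (\forall n \near \oo, forall t e : R, 0 < t -> 0 <= e -> eps n <= e ->
    (H1 n (~` [set w | (T n w < t)%R]) <= (e / t)%:E)%E) ->
  exists tau : nat -> R,
    strong_detection H0 H1 (fun n => [set w | T n w < tau n]).
Proof.
move=> b0 k0 e0 H0ge H1ge H0le H1le.
pose q n : R := `|beta n| + `|kappa n| + `|eps n| + harmonic n.
have q_gt0 n : 0 < q n by rewrite ltr_wpDl ?harmonic_gt0// !addr_ge0.
have q_ge n : [/\ beta n <= q n, kappa n <= q n & eps n <= q n].
  have := @harmonic_ge0 R n; have := ler_norm (beta n).
  have := ler_norm (kappa n); have := ler_norm (eps n).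
  have := normr_ge0 (beta n); have := normr_ge0 (kappa n).
  have := normr_ge0 (eps n); rewrite /q; move: (harmonic n) => h.
  by split; lra.
have q0 : q n @[n --> \oo] --> 0.
  have z : 0 = 0 + 0 + 0 + 0 :> R by rewrite !addr0.
  rewrite z; apply: cvgD; last exact: cvg_harmonic.
  by apply: cvgD; [apply: cvgD|]; exact/norm_cvg0P.
have sqrt0 (u : nat -> R) : u n @[n --> \oo] --> 0 ->
    Num.sqrt (u n) @[n --> \oo] --> 0.
  move=> u0; rewrite -(@sqrtr0 R).
  by apply: continuous_cvg => //; exact: sqrt_continuous.
pose s n := Num.sqrt (Num.sqrt (Num.sqrt (q n))).
have s_gt0 n : 0 < s n by rewrite !sqrtr_gt0.
have s_ge0 n : 0 <= s n by exact: ltW.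
have s0 : s n @[n --> \oo] --> 0 by do 3 apply: (sqrt0).
have s8 n : s n ^+ 8 = q n.
  by rewrite (_ : 8%N = (2 * 2 * 2)%N)// !exprM !sqr_sqrtr// ?sqrtr_ge0// ltW.
have s08 : ((8 * s n)%:E @[n --> \oo] --> 0%E)%E.
  apply: cvg_EFin; first exact: nearW.
  by rewrite -(mulr0 8); exact: cvgMl_tmp.
have s_lt1 : \forall n \near \oo, s n < 1 by exact: (cvgr_lt 0).
have pow k n : (0 < k)%N -> s n < 1 -> s n ^+ k <= s n.
  by move=> kp s1; apply: ler_iXnr => //; exact: ltW.
(* The bounds are [2 s + 4 s^5 + 2 s^4] and [s^6], both at most [8 s]. *)
exists (fun n => s n ^+ 2); split.
  apply: (squeeze_cvge _ (cvg_cst 0%E) s08); near=> n.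
  rewrite H0ge/=; have s1 : s n < 1 by near: n.
  have H : forall s : R, 0 < s -> (H0 n [set w | (T n w < s ^+ 2)%R] <=
     (2 * s + 4 * beta n / s ^+ 3 + 2 * kappa n / s ^+ 4)%:E)%E by near: n.
  apply: le_trans (H _ (s_gt0 n)) _; rewrite lee_fin.
  have [bq kq _] := q_ge n; rewrite -!s8 in bq kq.
  have b1 : beta n / s n ^+ 3 <= s n.
    rewrite ler_pdivrMr ?exprn_gt0// (le_trans bq)//.
    rewrite (_ : 8%N = (5 + 3)%N)// exprD ler_wpM2r ?exprn_ge0//.
    exact: (pow).
  have k1 : kappa n / s n ^+ 4 <= s n.
    rewrite ler_pdivrMr ?exprn_gt0// (le_trans kq)//.
    rewrite (_ : 8%N = (4 + 4)%N)// exprD ler_wpM2r ?exprn_ge0//.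
    exact: (pow).
  by rewrite -!mulrA; lra.
apply: (squeeze_cvge _ (cvg_cst 0%E) s08); near=> n.
rewrite H1ge/=; have s1 : s n < 1 by near: n.
have H : forall t e : R, 0 < t -> 0 <= e -> eps n <= e ->
  (H1 n (~` [set w | (T n w < t)%R]) <= (e / t)%:E)%E by near: n.
have [_ _ eq_] := q_ge n.
apply: le_trans (H _ _ _ (ltW (q_gt0 n)) eq_) _; first exact: exprn_gt0.
rewrite lee_fin ler_pdivrMr ?exprn_gt0// -s8.
rewrite (_ : 8%N = (6 + 2)%N)// exprD ler_wpM2r ?exprn_ge0//.
have := pow 6 n isT s1; have := ltW (s_gt0 n); lra.
Unshelve. all: by end_near. Qed.

End asymptotics.

Theorem theorem3 (R : realType) (dX dY : nat -> measure_display)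
    (X : forall n, measurableType (dX n)) (Y : forall n, measurableType (dY n))
    (P : forall n, probability (X n * Y n)%type R) (m : nat -> nat)
    (lambda : nat -> nat -> R)
    (phi : forall n, nat -> X n -> R) (psi : forall n, nat -> Y n -> R)
    (hchi2 : forall n, (chi2_information (P n) < +oo)%E)
    (hdecomp : forall n,
      spectral_decomposition (P n) (lambda n) (@phi n) (@psi n))
    (hmn : forall n, (m n <= n)%N)
    (hm : (m n)%:R / n%:R @[n --> \oo] --> (1 : R))
    (hthird :
      ('E_(marginalX (P n))[fun x => (`|phi n 1%N x ^+ 3|)%R]
         * ((Num.sqrt n%:R)^-1)%R%:E)%E @[n --> \oo] --> (0 : \bar R)%E
      \/
      ('E_(marginalY (P n))[fun y => (`|psi n 1%N y ^+ 3|)%R]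
         * ((Num.sqrt (m n)%:R)^-1)%R%:E)%E @[n --> \oo] --> (0 : \bar R)%E)
    (hrho : maximal_correlation (P n) @[n --> \oo] --> (1 : \bar R)%E) :
  exists tau : nat -> R,
    strong_detection
      (fun n => null_law (P n) n (m n))
      (fun n => planted_law (P n) n (m n))
      (fun n => [set w | T_top (phi n 1%N) (psi n 1%N) w < tau n]).
Proof.
have l_cvg : lambda n 1%N @[n --> \oo] --> (1 : R).
  apply: (@fine_cvg _ _ _ _ (fun n => (lambda n 1%N)%:E)).
  apply: (squeeze_cvge _ hrho (cvg_cst 1%E)); apply: nearW => n.
  rewrite (maximal_correlation_le (hchi2 n) (hdecomp n))/= lee_fin.
  by have [[<- /(_ 0%N)/andP[]]] := hdecomp n.
have l_gt0 : \forall n \near \oo, 0 < lambda n 1%N by exact: (cvgr_gt 1).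
have m_gt0 : \forall n \near \oo, (0 < m n)%N.
  have : \forall n \near \oo, 0 < (m n)%:R / n%:R :> R by exact: (cvgr_gt 1).
  apply: filterS => n; rewrite lt0n; apply: contraTN => /eqP ->.
  by rewrite mul0r ltxx.
pose eps n : R := 2 - 2 * (Num.sqrt ((m n)%:R / n%:R) * lambda n 1%N).
have eps0 : eps n @[n --> \oo] --> (0 : R).
  have -> : (0 : R) = 2 - 2 * (Num.sqrt 1 * 1) by rewrite sqrtr1; lra.
  apply: cvgB; first exact: cvg_cst.
  apply: cvgMl_tmp; apply: cvgM => //.
  by apply: continuous_cvg => //; exact: sqrt_continuous.
have invn : (n%:R^-1 : R) @[n --> \oo] --> (0 : R).
  rewrite -(@cvg_shiftS R); exact: cvg_harmonic.
have invm : ((m n)%:R^-1 : R) @[n --> \oo] --> (0 : R).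
  have : ((m n)%:R / n%:R)^-1 * n%:R^-1 @[n --> \oo] --> (1^-1 * 0 : R).
    by apply: cvgM => //; apply: cvgV => //; exact: oner_neq0.
  rewrite mulr0; apply: cvg_trans; apply: near_eq_cvg; near=> n.
  have m0 : (0 < m n)%N by near: n.
  have n0 : (0 < n)%N by exact: leq_trans (hmn n).
  by field; rewrite !pnatr_eq0 -!lt0n m0 n0.
have H1le : \forall n \near \oo, forall t e : R, 0 < t -> 0 <= e -> eps n <= e ->
    (planted_law (P n) n (m n)
      (~` [set w | (T_top (phi n 1%N) (psi n 1%N) w < t)%R]) <= (e / t)%:E)%E.
  near=> n => t e t0 e0 ee.
  have l0 : 0 < lambda n 1%N by near: n.
  have m0 : (0 < m n)%N by near: n.
  have [p0 p1] := phi1_moments (hdecomp n) l0.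
  have [q0 q1] := psi1_moments (hdecomp n) l0.
  exact: (planted_law_le p0 p1 q0 q1 m0 (hmn n)
    (phi1_psi1_correlation (hchi2 n) (hdecomp n) l0)).
have H1ge n A : (0 <= planted_law (P n) n (m n) A)%E.
  by rewrite mule_ge0 ?lee_fin ?invr_ge0// sume_ge0.
have H0ge n A : (0 <= null_law (P n) n (m n) A)%E by exact: measure_ge0.
case: hthird => third.
- have /fine_cvgP[third_fin third0] := third.
  apply: (strong_detection_of_rates third0 invn eps0) => //.
  near=> n => s s0.
  have l0 : 0 < lambda n 1%N by near: n.
  have m0 : (0 < m n)%N by near: n.
  have [p0 p1] := phi1_moments (hdecomp n) l0.
  have [q0 q1] := psi1_moments (hdecomp n) l0.
  have [||||b hb bE] := @has_mean_scaled_expectation _ _ _ (marginalX (P n))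
    (fun x => `|phi n 1%N x ^+ 3|) (Num.sqrt n%:R)^-1.
  + apply: measurableT_comp => //; apply: measurable_funX.
    exact: has_mean_measurable p0.
  + by [].
  + by rewrite invr_gt0 sqrtr_gt0 ltr0n (leq_trans m0).
  + by near: n.
  by rewrite /= -bE; exact: null_law_le_X.
- have /fine_cvgP[third_fin third0] := third.
  apply: (strong_detection_of_rates third0 invm eps0) => //.
  near=> n => s s0.
  have l0 : 0 < lambda n 1%N by near: n.
  have m0 : (0 < m n)%N by near: n.
  have [p0 p1] := phi1_moments (hdecomp n) l0.
  have [q0 q1] := psi1_moments (hdecomp n) l0.
  have [||||b hb bE] := @has_mean_scaled_expectation _ _ _ (marginalY (P n))
    (fun x => `|psi n 1%N x ^+ 3|) (Num.sqrt (m n)%:R)^-1.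
  + apply: measurableT_comp => //; apply: measurable_funX.
    exact: has_mean_measurable q0.
  + by [].
  + by rewrite invr_gt0 sqrtr_gt0 ltr0n.
  + by near: n.
  by rewrite /= -bE; exact: null_law_le_Y.
Unshelve. all: by end_near. Qed.
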